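(* Let $X$ be a regular curve and let $f:X\to X$ be a homeomorphism. Then the following assertions are equivalent: (1) The map $\omega_f:X\to 2^X$, $x\mapsto\omega_f(x)$, is continuous. (2) The $\omega$-limit set of any point coincides with its $\alpha$-limit set, i.e. $\omega_f(x)=\alpha_f(x)$ for every $x\in X$. (3) The map $\alpha_f:X\to 2^X$, $x\mapsto\alpha_f(x)$, is continuous.
   Context: A continuum is a nonempty connected compact metric space. A continuum $X$ is a regular curve if for each $x\in X$ and each open neighborhood $V$ of $x$ in $X$ there is an open neighborhood $U$ of $x$ in $X$ with $U\subset V$ and with finite boundary $\partial U$. $2^X$ denotes the hyperspace of all nonempty closed subsets of $X$, endowed with the Hausdorff metric $d_H(A,B)=\max\{\sup_{x\in A}d(x,B),\sup_{y\in B}d(y,A)\}$. The $\omega$-limit set of $x$ is $\omega_f(x)=\{y\in X:\exists\, n_i\in\mathbb{N},\ n_i\to\infty,\ \lim_{i\to\infty}d(f^{n_i}(x),y)=0\}$, and the $\alpha$-limit set is $\alpha_f(x)=\omega_{f^{-1}}(x)$; both are nonempty and closed. *)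

(* Defs.v *)
From HB Require Import structures.
From mathcomp Require Import all_boot all_order all_algebra.
From mathcomp Require Import all_classical all_reals all_analysis.

Set Implicit Arguments.
Unset Strict Implicit.
Unset Printing Implicit Defensive.

Import Order.TTheory GRing.Theory Num.Theory.
Import numFieldNormedType.Exports.

Local Open Scope classical_set_scope.
Local Open Scope ring_scope.

HB.mixin Record Metric_isContinuum (R : realType) M & Metric R M := {
  continuum_neq0 : [set: M] !=set0 ;
  continuum_connected : connected [set: M] ;
  continuum_compact : compact [set: M]
}.

#[short(type="continuumType")]
HB.structure Definition Continuum (R : realType) :=
  { M of Metric R M & Metric_isContinuum R M }.

Definition boundary (T : topologicalType) (A : set T) : set T :=
  closure A `&` closure (~` A).

Definition regular_curve (R : realType) (X : continuumType R) : Prop :=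
  forall (x : X) (V : set X), open V -> V x ->
  exists U : set X, [/\ open U, U x, U `<=` V & finite_set (boundary U)].

Record homeomorphism (T : topologicalType) := Homeomorphism {
  homeo_fun :> T -> T ;
  homeo_inv : T -> T ;
  homeo_funK : cancel homeo_fun homeo_inv ;
  homeo_invK : cancel homeo_inv homeo_fun ;
  homeo_fun_continuous : continuous homeo_fun ;
  homeo_inv_continuous : continuous homeo_inv
}.

(* inf and sup take values in R and are meaningless on empty or unbounded sets;
   this does not occur for nonempty subsets of a continuum, which is bounded
   (continuum_bounded). *)
Definition dist_to (R : realType) (X : metricType R) (x : X) (B : set X) : R :=
  inf [set mdist x b | b in B].

Definition excess (R : realType) (X : metricType R) (A B : set X) : R :=
  sup [set dist_to a B | a in A].

Definition hausdorff_dist (R : realType) (X : metricType R) (A B : set X) : R :=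
  Num.max (excess A B) (excess B A).

Record hyperspace (R : realType) (X : continuumType R) := Hyperspace {
  hyperspace_set :> set X ;
  hyperspace_neq0 : hyperspace_set !=set0 ;
  hyperspace_closed : closed hyperspace_set
}.

HB.instance Definition _ (R : realType) (X : continuumType R) :=
  gen_eqMixin (hyperspace X).
HB.instance Definition _ (R : realType) (X : continuumType R) :=
  gen_choiceMixin (hyperspace X).

Section hausdorff_dist_metric.
Context {R : realType} {X : continuumType R}.
Implicit Types (x y : X) (A B C : hyperspace X).

Lemma continuum_bounded : exists D : R, forall x y, mdist x y <= D.
Proof.
have [x0 _] := @continuum_neq0 R X.
suff [D hD] : exists D : R, forall x, mdist x0 x <= D.
  exists (D + D) => x y; apply: (le_trans (metric_triangle x x0 y)).
  by rewrite metric_sym lerD.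
apply: contrapT => /forallNP nb.
have /choice[u hu] : forall n : nat, exists x, n%:R < mdist x0 x.
  move=> n; have /existsNP[x hx] := nb n%:R.
  by exists x; rewrite ltNge; apply/negP.
have [|p [_ clp]] :=
  @continuum_compact R X (u n @[n --> \oo]) (fmap_proper_filter _ _).
  exact: filterT.
pose N := (Num.truncn (mdist x0 p + 1)).+1.
have uN : (u n @[n --> \oo]) [set z | mdist x0 p + 1 < mdist x0 z].
  exists N => // n /= Nn; apply: (le_lt_trans _ (hu n)).
  apply: (@le_trans _ _ N%:R); last by rewrite ler_nat.
  by rewrite /N; apply/ltW/truncnS_gt.
have [z [/= z1]] := clp _ _ uN (nbhsx_ballx p 1 ltr01).
rewrite ballEmdist/= => z2.
have : mdist x0 z < mdist x0 p + 1.
  by rewrite (le_lt_trans (metric_triangle x0 p z))// ltrD2l.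
by move=> /lt_trans-/(_ _ z1); rewrite ltxx.
Qed.

Lemma dist_to_ge0 x B : 0 <= dist_to x B.
Proof.
apply: lb_le_inf; last by move=> _ [b _ <-]; exact: mdist_ge0.
by have [b Bb] := hyperspace_neq0 B; exists (mdist x b), b.
Qed.

Lemma dist_to_le x B b : (B : set X) b -> dist_to x B <= mdist x b.
Proof.
move=> Bb; apply: ge_inf; last by exists b.
by exists 0 => _ [c _ <-]; exact: mdist_ge0.
Qed.

Lemma dist_to_lt x B (e : R) : dist_to x B < e ->
  exists2 b, (B : set X) b & mdist x b < e.
Proof.
move=> xe; have [|_ [b Bb <-] be] := inf_lt _ xe; last by exists b.
by have [b Bb] := hyperspace_neq0 B; exists (mdist x b), b.
Qed.

Lemma dist_to_excess A B x : (A : set X) x -> dist_to x B <= excess A B.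
Proof.
move=> Ax; apply: ub_le_sup; last by exists x.
have [D hD] := continuum_bounded; exists D => _ [a _ <-].
have [b Bb] := hyperspace_neq0 B.
exact: le_trans (dist_to_le _ Bb) _.
Qed.

Lemma excess_le A B (c : R) :
  (forall x, (A : set X) x -> dist_to x B <= c) -> excess A B <= c.
Proof.
move=> h; apply: ge_sup; last by move=> _ [a Aa <-]; exact: h.
by have [a Aa] := hyperspace_neq0 A; exists (dist_to a B), a.
Qed.

Lemma excess_ge0 A B : 0 <= excess A B.
Proof.
have [a Aa] := hyperspace_neq0 A.
exact: le_trans (dist_to_ge0 a B) (dist_to_excess _ Aa).
Qed.

Lemma excessxx A : excess A A = 0.
Proof.
apply/eqP; rewrite eq_le excess_ge0 andbT; apply: excess_le => x Ax.
by rewrite (le_trans (dist_to_le _ Ax))// mdistxx.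
Qed.

Lemma excess_triangle B A C : excess A C <= excess A B + excess B C.
Proof.
apply: excess_le => x Ax; apply/ler_addgt0Pr => e e0.
have e2 : 0 < e / 2 by rewrite divr_gt0.
have [b Bb xb] : exists2 b, (B : set X) b & mdist x b < excess A B + e / 2.
  by apply: dist_to_lt; rewrite (le_lt_trans (dist_to_excess _ Ax))// ltrDl.
have [c Cc bc] : exists2 c, (C : set X) c & mdist b c < excess B C + e / 2.
  by apply: dist_to_lt; rewrite (le_lt_trans (dist_to_excess _ Bb))// ltrDl.
rewrite (le_trans (dist_to_le _ Cc))// (le_trans (metric_triangle x b c))//.
by rewrite [e]splitr addrACA lerD// ltW.
Qed.

Lemma excess_eq0 A B : excess A B <= 0 -> (A : set X) `<=` B.
Proof.
move=> AB0 x Ax; rewrite ((closure_id _).1 (@hyperspace_closed _ _ B)) => U.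
rewrite -filter_from_ballE => -[e /= e0 eU].
have [b Bb xb] : exists2 b, (B : set X) b & mdist x b < e.
  apply: dist_to_lt; apply: le_lt_trans e0.
  exact: le_trans (dist_to_excess _ Ax) _.
by exists b; split=> //; apply: eU; rewrite ballEmdist.
Qed.

Lemma hausdorff_distxx A : hausdorff_dist A A = 0.
Proof. by rewrite /hausdorff_dist excessxx maxxx. Qed.

Lemma hausdorff_dist_positivity A B : hausdorff_dist A B = 0 -> A = B.
Proof.
move=> AB0; have : hausdorff_dist A B <= 0 by rewrite AB0.
rewrite /hausdorff_dist ge_max => /andP[/excess_eq0 AB /excess_eq0 BA].
have : (A : set X) = B by exact/seteqP.
case: A B {AB0 AB BA} => [A A0 cA] [B B0 cB] /= AB; subst B.
by congr Hyperspace; exact: Prop_irrelevance.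
Qed.

Lemma hausdorff_dist_sym A B : hausdorff_dist A B = hausdorff_dist B A.
Proof. exact: maxC. Qed.

Lemma hausdorff_dist_triangle B A C :
  hausdorff_dist A C <= hausdorff_dist A B + hausdorff_dist B C.
Proof.
rewrite {1}/hausdorff_dist ge_max; apply/andP; split.
  by rewrite (le_trans (excess_triangle B A C))// lerD// le_max lexx.
rewrite (le_trans (excess_triangle B C A))// addrC.
by rewrite lerD// le_max lexx orbT.
Qed.

HB.instance Definition _ := @isMetric.Build R (hyperspace X)
  (fun A B => hausdorff_dist A B) hausdorff_distxx hausdorff_dist_positivity
  hausdorff_dist_sym hausdorff_dist_triangle.

Lemma hyperspace_mdistE A B : mdist A B = hausdorff_dist A B.
Proof. by []. Qed.

End hausdorff_dist_metric.

Definition omega_limit_set (R : realType) (X : metricType R) (f : X -> X)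
    (x : X) : set X :=
  [set y | exists n : nat -> nat, n @ \oo --> \oo /\
     mdist (iter (n i) f x) y @[i --> \oo] --> (0 : R)].

Definition alpha_limit_set (R : realType) (X : metricType R)
    (f : homeomorphism X) (x : X) : set X :=
  omega_limit_set (homeo_inv f) x.

Lemma omega_limit_setE (R : realType) (X : metricType R) (f : X -> X) (x : X) :
  omega_limit_set f x = cluster (iter n f x @[n --> \oo]).
Proof.
apply/seteqP; split=> [y [n [noo /cvgrPdist_lt ny]] A B|y cy].
  move=> [N _ hN]; rewrite -filter_from_ballE => -[e /= e0 eB].
  have Nn : \forall i \near \oo, (N <= n i)%N.
    by apply: (noo [set m | (N <= m)%N]); exists N.
  near \oo => i; exists (iter (n i) f x); split.
    by apply: hN => /=; near: i.
  apply: eB; rewrite ballEmdist/= metric_sym.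
  rewrite -[X in X < _]ger0_norm ?mdist_ge0// -normrN -sub0r.
  by near: i; exact: ny.
have /choice[n hn] : forall i : nat, exists m : nat,
    (i <= m)%N /\ mdist (iter m f x) y < i.+1%:R^-1.
  move=> i; have i0 : 0 < i.+1%:R^-1 :> R by rewrite invr_gt0.
  have iA : (iter n f x @[n --> \oo]) [set iter m f x | m in [set m | i <= m]%N].
    by exists i => // m im; exists m.
  have [_ [[m im <-]]] := cy _ _ iA (nbhsx_ballx y _ i0).
  by rewrite ballEmdist/= metric_sym => ym; exists m.
exists n; split.
  move=> A [N _ NA]; exists N => // i /= Ni; apply: NA => /=.
  exact: leq_trans Ni (hn i).1.
apply/cvgrPdist_lt => e e0; near=> i.
rewrite sub0r normrN ger0_norm ?mdist_ge0// (lt_trans (hn i).2)//.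
by near: i; exact: near_infty_natSinv_lt (PosNum e0).
Unshelve. all: by end_near. Qed.

Lemma omega_limit_set_neq0 (R : realType) (X : continuumType R) (f : X -> X)
  (x : X) : omega_limit_set f x !=set0.
Proof.
rewrite omega_limit_setE.
have [|y [_ cy]] :=
  @continuum_compact R X (iter n f x @[n --> \oo]) (fmap_proper_filter _ _).
  exact: filterT.
by exists y.
Qed.

Lemma omega_limit_set_closed (R : realType) (X : continuumType R) (f : X -> X)
  (x : X) : closed (omega_limit_set f x).
Proof.
rewrite omega_limit_setE clusterE; apply: closed_bigI => A _.
exact: closed_closure.
Qed.

Definition omega_limit (R : realType) (X : continuumType R) (f : X -> X)
    (x : X) : hyperspace X :=
  Hyperspace (@omega_limit_set_neq0 R X f x) (@omega_limit_set_closed R X f x).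

Definition alpha_limit (R : realType) (X : continuumType R)
    (f : homeomorphism X) (x : X) : hyperspace X :=
  omega_limit (homeo_inv f) x.

(* Main.v *)
Require Import Defs.
From HB Require Import structures.
From mathcomp Require Import all_boot all_order all_algebra.
From mathcomp Require Import all_classical all_reals all_analysis.
From mathcomp Require Import lra zify.

Set Implicit Arguments.
Unset Strict Implicit.
Unset Printing Implicit Defensive.

Import Order.TTheory GRing.Theory Num.Theory.
Import numFieldNormedType.Exports.

Local Open Scope classical_set_scope.
Local Open Scope ring_scope.

(* Write O for the orbit of a periodic point x. Since X is covered by finitely
   many small open sets with finite boundary, there is a finite set that meets
   every connected set of diameter at least e; as X is also locally connected,
   an iterate of f can expand only boundedly many of any family of disjoint
   small connected sets. If y is aperiodic, u_i -> y, f^(k_i) u_i -> w and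
   f^(k_i) y -> w', applying this to neighbourhoods of many points f^m y shows
   that f^m w and f^m w' get close as |m| -> oo. If moreover w <> w', then a
   point p on the finite boundary of a small neighbourhood of w' satisfies
   f^(-k_i) p -> y, and it too is biasymptotic to w'; for k_i -> +oo this puts
   y in the alpha-limit set of w'. Consequently nonwandering points are
   recurrent and omega_f is continuous at every aperiodic point, whatever f.

   (1) => (2): if y is in the alpha-limit set of x, continuity of omega_f at y
   gives omega(y) = omega(x), and y is recurrent; the other inclusion holds
   because alpha(x) is closed and invariant.

   (2) => (1): only periodic points x remain. First, an omega-limit set that
   contains x reduces to O. If omega_f were discontinuous at x, orbits starting
   near x would leave the balls around O; the limits of their exit points are
   periodic points on all small spheres around O, each approximated by points
   whose orbits converge to O. A common power of f fixes many of these periodic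
   points while it moves their approximants close to O, which expands too many
   disjoint small sets.

   (3) is (1) for the inverse of f. *)

(** * Connected sets in regular curves *)

(** Otherwise the traces of [U] and [closure U] on [C] agree, so that [U] cuts out a proper nonempty
    clopen part of [C]. *)
Lemma connected_meets_boundary (T : topologicalType) (C U : set T) (a b : T) :
  connected C -> open U -> C a -> U a -> C b -> ~ U b ->
  exists2 p, C p & boundary U p.
Proof.
move=> Cc oU Ca Ua Cb nUb; apply: contrapT => nex; apply: nUb.
suff CU : C `&` U = C by have [] : (C `&` U) b by rewrite CU.
apply: Cc; first by exists a.
  by exists U.
exists (closure U); first exact: closed_closure.
apply/seteqP; split=> [p [Cp Up]|p [Cp clp]].
  by split=> //; exact: subset_closure.
split=> //; apply: contrapT => nUp; apply: nex; exists p => //.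
by split=> //; exact: subset_closure.
Qed.

Lemma count_lt (T : eqType) (a1 a2 : pred T) (s : seq T) (p : T) :
  subpred a1 a2 -> p \in s -> a2 p -> ~~ a1 p ->
  (count a1 s < count a2 s)%N.
Proof.
move=> a12 + a2p na1p; elim: s => //= y s IH; rewrite in_cons => /orP[/eqP<-|].
  by rewrite a2p (negbTE na1p) ltnS sub_count.
move=> /IH lt; rewrite -addnS leq_add//.
by case: (boolP (a1 y)) => // /a12->.
Qed.

Lemma filter_all_seq (I : eqType) T (F : set_system T) (s : seq I)
    (P : I -> set T) : Filter F ->
  (forall p, p \in s -> F (P p)) -> F [set t | forall p, p \in s -> P p t].
Proof.
move=> FF; elim: s => [|a s IH] h; first by apply: filterS filterT => t _ p.
have Fa : F (P a) by apply: h; rewrite mem_head.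
have Fs : F [set t | forall p, p \in s -> P p t].
  by apply: IH => p ps; apply: h; rewrite in_cons ps orbT.
apply: filterS2 Fa Fs => t at_ st p; rewrite in_cons => /orP[/eqP->//|].
exact: st.
Qed.

Lemma common_radius (R : realType) (I : finType) (P : I -> R -> Prop) :
  (forall i e e', 0 < e' -> e' <= e -> P i e -> P i e') ->
  (forall i, exists2 e, 0 < e & P i e) ->
  exists2 e, 0 < e & forall i, P i e.
Proof.
move=> Pdown /(_ _)/cid2-/all_sig2[e e0 Pe].
have m0 : 0 < \big[Num.min/1]_i e i by rewrite lt_bigmin.
exists (\big[Num.min/1]_i e i) => // i; apply: Pdown (Pe i) => //.
exact: bigmin_le.
Qed.

Lemma nbhs_mdist_exP (R : realType) (X : metricType R) (x : X) (V : set X) :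
  nbhs x V <-> exists2 e : R, 0 < e & forall y, mdist x y < e -> V y.
Proof.
rewrite -filter_from_ballE; split=> -[e /= e0 eV]; exists e => //.
  by move=> y xy; apply: eV; rewrite ballEmdist.
by move=> y; rewrite ballEmdist; exact: eV.
Qed.

Lemma closure_mdist (R : realType) (X : metricType R) (U : set X) (x z : X)
    (e : R) :
  (forall y, U y -> mdist x y < e) -> closure U z -> mdist x z <= e.
Proof.
move=> Ue clz; apply/ler_addgt0Pr => r r0.
have [y [/Ue xy]] := clz _ (nbhsx_ballx z r r0).
rewrite ballEmdist/= => zy; apply: le_trans (metric_triangle x y z) _.
by rewrite lerD// ltW// metric_sym.
Qed.

Section regular_curve_topology.
Context {R : realType} {X : continuumType R}.
Hypothesis hX : regular_curve X.

Lemma regular_nbhs (x : X) (e : R) : 0 < e ->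
  exists (U : set X) (s : seq X), [/\ open U, U x,
    forall y, closure U y -> mdist x y < e & boundary U = [set` s]].
Proof.
move=> e0; have e2 : 0 < e / 2 by rewrite divr_gt0.
have oB := @open_interior X (ball x (e / 2)).
have [U [oU Ux UB /finite_seqP[s bU]]] := hX oB (nbhsx_ballx x _ e2).
exists U, s; split=> // y clUy; apply: (@le_lt_trans _ _ (e / 2)); last lra.
apply: closure_mdist clUy => z /UB/interior_subset.
by rewrite ballEmdist.
Qed.

(* A clopen piece of the closure of [U] misses the boundary of [U] only if it
   is clopen in [X]; so among the clopen pieces containing [x], one with the
   fewest boundary points cannot be split. *)
Lemma regular_connected_nbhs (x : X) (e : R) : 0 < e ->
  exists Q : set X, [/\ connected Q, nbhs x Q & forall y, Q y -> mdist x y < e].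
Proof.
move=> /(regular_nbhs x)[U [s [oU Ux Ue bU]]].
pose piece Q := closed Q /\ exists2 W, open W & Q = closure U `&` W.
have meets Q z : piece Q -> Q !=set0 -> ~ Q z -> exists2 p, p \in s & Q p.
  move=> [cQ [W oW QW]] Q0 nQz; apply: contrapT => nex; apply: nQz.
  suff -> : Q = setT by [].
  apply: (@continuum_connected R X) => //; last by exists Q; rewrite ?setTI.
  exists (U `&` W); first exact: openI.
  rewrite setTI; apply/seteqP; split=> y; last first.
    by move=> [Uy Wy]; rewrite QW; split=> //; exact: subset_closure.
  move=> Qy; have := Qy; rewrite {1}QW => -[clUy Wy]; split=> //.
  apply: contrapT => nUy; apply: nex; exists y => //.
  have : boundary U y by split=> //; exact: subset_closure.
  by rewrite bU.
suff H n Q : (count (fun p => `[< Q p >]) s <= n)%N -> piece Q -> Q x ->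
    exists Q', [/\ connected Q', piece Q' & Q' x].
  have [||Q [Qc [_ [W oW QW]] Qx]] := H _ (closure U) (leqnn _).
  - split; first exact: closed_closure.
    by exists setT; [exact: openT|rewrite setIT].
  - exact: subset_closure.
  exists Q; split=> // [|y]; last by rewrite QW => -[/Ue].
  have : nbhs x (U `&` W).
    apply: open_nbhs_nbhs; split; first exact: openI.
    by split=> //; have := Qx; rewrite QW => -[].
  by apply: filterS => y [Uy Wy]; rewrite QW; split=> //; exact: subset_closure.
elim: n Q => [|n IH] Q Qn pQ Qx.
  exists Q; split=> // B [b Bb] [C1 oC1 BC1] [C2 cC2 BC2].
  apply/seteqP; split=> [z|z Qz]; first by rewrite BC1 => -[].
  apply: contrapT => nBz; have [p ps Bp] : exists2 p, p \in s & B p.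
    apply: (meets _ z) => //; last by exists b.
    case: pQ => cQ [W oW QW]; split; first by rewrite BC2; exact: closedI.
    by exists (W `&` C1); [exact: openI|rewrite BC1 QW setIA].
  have : has (fun p => `[< Q p >]) s.
    by apply/hasP; exists p => //; apply/asboolP; move: Bp; rewrite BC1 => -[].
  by rewrite has_count ltnNge Qn.
have [Qc|] := pselect (connected Q); first by exists Q.
move=> /existsNP[B] /not_implyP[[b Bb] /not_implyP[[C1 oC1 BC1]]].
move=> /not_implyP[[C2 cC2 BC2] BQ].
have [z [Qz nBz]] : exists z, Q z /\ ~ B z.
  apply: contrapT => nex; apply: BQ; apply/seteqP; split=> z.
    by rewrite BC1 => -[].
  by move=> Qz; apply: contrapT => nBz; apply: nex; exists z.
have BsubQ : B `<=` Q by move=> y; rewrite BC1 => -[].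
have pB : piece B.
  case: pQ => cQ [W oW QW]; split; first by rewrite BC2; exact: closedI.
  by exists (W `&` C1); [exact: openI|rewrite BC1 QW setIA].
have pB' : piece (Q `\` B).
  case: pQ => cQ [W oW QW]; split.
    rewrite (_ : Q `\` B = Q `&` ~` C1).
      by apply: closedI => //; exact: open_closedC.
    apply/seteqP; split=> y [Qy h]; split=> // h'; apply: h.
      by rewrite BC1.
    by move: h'; rewrite BC1 => -[].
  exists (W `&` ~` C2); first by apply: openI => //; exact: closed_openC.
  rewrite setIA -QW; apply/seteqP; split=> y [Qy h]; split=> // h'; apply: h.
    by rewrite BC2.
  by move: h'; rewrite BC2 => -[].
(* By [meets], [Q2] contains a point of [s], which [Q1] loses; the count drops and the induction
   hypothesis applies to [Q1]. *)
have split Q1 Q2 : Q1 `<=` Q -> Q2 `<=` Q -> piece Q1 -> piece Q2 ->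
    Q2 !=set0 -> Q1 x -> Q1 `&` Q2 = set0 ->
    exists Q', [/\ connected Q', piece Q' & Q' x].
  move=> Q1Q Q2Q p1 p2 Q20 Q1x Q12.
  have nQ2x : ~ Q2 x by move=> Q2x; have : (Q1 `&` Q2) x by []; rewrite Q12.
  have [p ps Q2p] := meets _ x p2 Q20 nQ2x.
  apply: (IH Q1) => //; rewrite -ltnS; apply: leq_trans Qn.
  apply: (@count_lt _ _ _ _ p) => //; first by move=> y /asboolP/Q1Q/asboolP.
    by apply/asboolP; exact: Q2Q.
  apply/asboolP => Q1p.
  by have : (Q1 `&` Q2) p by []; rewrite Q12.
have [Bx|nBx] := pselect (B x).
  apply: (split B (Q `\` B)) => //.
  - by exists z.
  - by apply/seteqP; split=> // y [By [_ /(_ By)]].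
apply: (split (Q `\` B) B) => //.
- by exists b.
- by apply/seteqP; split=> // y [[_ nBy] /nBy].
Qed.

(** Finitely many [U x] cover the space, and [s] collects their boundaries. The member of the cover
    around [a] is too small to contain [b], so [C] crosses its boundary. *)
Lemma connected_finite_net (e : R) : 0 < e -> exists s : seq X,
  forall C a b, connected C -> C a -> C b -> e <= mdist a b ->
  exists2 p, p \in s & C p.
Proof.
move=> e0; have e2 : 0 < e / 2 by rewrite divr_gt0.
have /choice[U /choice[bd hU]] := fun x => regular_nbhs x e2.
have : cover_compact [set: X].
  (* [compact_cover] is only stated for pointed spaces. *)
  have [x0 _] := @continuum_neq0 R X.
  pose pX : ptopologicalType := HB.pack X (isPointed.Build X x0).
  have := @continuum_compact R X.
  by have := @compact_cover pX => /(congr1 (@^~ setT))/= ->.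
move=> /(_ X setT U)[|x _|D _ cD].
- by move=> x _; have [] := hU x.
- by exists x => //; have [] := hU x.
exists (flatten [seq bd x | x <- finmap.enum_fset D]) => C a b Cc Ca Cb ab.
have [x /= xD Ua] := cD a I.
have [oU Ux Ue bU] := hU x.
have nUb : ~ U x b.
  move=> Ub; have := metric_triangle a x b; rewrite (metric_sym a x).
  have := Ue _ (subset_closure Ua); have := Ue _ (subset_closure Ub); lra.
have [p Cp] := connected_meets_boundary Cc oU Ca Ua Cb nUb.
rewrite bU => ps; exists p => //; apply/flattenP; exists (bd x) => //.
by apply/mapP; exists x.
Qed.

(* Iterates of a homeomorphism can expand only boundedly many of any family of
   small balls: small disjoint connected neighbourhoods of the [v j] have
   disjoint connected images, and those that are large meet a finite set. *)
Lemma finite_spread (e : R) : 0 < e -> exists K : nat,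
  forall v : 'I_K -> X, injective v ->
  exists2 d : R, 0 < d & forall (g : X -> X) (a : 'I_K -> X),
  continuous g -> injective g -> (forall j, mdist (v j) (a j) < d) ->
  exists j, mdist (g (v j)) (g (a j)) < e.
Proof.
(* One point more than the net has, for the pigeonhole principle. *)
move=> /connected_finite_net[s hs]; exists (size s).+1 => v vinj.
pose far i j r := i <> j -> r + r <= mdist (v i) (v j).
have [r r0 hr] : exists2 r : R, 0 < r & forall ij, far ij.1 ij.2 r.
  apply: common_radius => [[i j] r r' r'0 r'r far_ij ij|[i j]]/=.
    by rewrite (le_trans _ (far_ij ij))// lerD.
  have [->|ij] := eqVneq i j; first by exists 1.
  exists (mdist (v i) (v j) / 2) => [|_]; last by rewrite -splitr.
  by rewrite divr_gt0// mdist_gt0; apply: contra_neq ij => /vinj.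
have /choice[Q hQ] := fun j => regular_connected_nbhs (v j) r0.
have [d d0 hd] : exists2 d : R, 0 < d &
    forall j a, mdist (v j) a < d -> Q j a.
  apply: common_radius => [j d d' d'0 d'd h a va|j].
    by apply: h; exact: lt_le_trans d'd.
  by have [_ /nbhs_mdist_exP] := hQ j.
exists d => // g a gc ginj va; apply: contrapT => /forallNP far_ga.
have /choice[p hp] : forall j, exists p, p \in s /\ (g @` Q j) p.
  move=> j; have [Qc nQ _] := hQ j.
  have [||||p] := hs (g @` Q j) (g (v j)) (g (a j)); last by exists p.
  - apply: connected_continuous_connected => //.
    exact: continuous_subspaceT.
  - by exists (v j) => //; exact: nbhs_singleton.
  - by exists (a j) => //; exact: hd.
  - by rewrite leNgt; apply/negP; exact: far_ga.
have pinj : injective p.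
  move=> i j pij; apply: contrapT => ij.
  have [_ [y Qy gy]] := hp i; have [_ [z Qz gz]] := hp j.
  have yz : y = z by apply: ginj; rewrite gy gz.
  have [_ _ /(_ _ Qy) viy] := hQ i; have [_ _ /(_ _ Qz) vjz] := hQ j.
  have := hr (i, j) ij; have := metric_triangle (v i) y (v j).
  by move: viy vjz; rewrite yz (metric_sym z) /=; lra.
have := @uniq_leq_size _ [seq p i | i <- enum 'I_(size s).+1] s.
rewrite map_inj_uniq// enum_uniq => /(_ isT).
rewrite size_map size_enum_ord ltnn => h.
by suff : false by []; apply: h => _ /mapP[i _ ->]; have [] := hp i.
Qed.

End regular_curve_topology.

(** * Iterates and limits along ultrafilters *)

Lemma cvg_mdist (R : realType) (X : metricType R) I (F : set_system I)
    {FF : Filter F} (u : I -> X) (l : X) (e : R) :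
  u i @[i --> F] --> l -> 0 < e -> \forall i \near F, mdist l (u i) < e.
Proof.
move=> ul e0; apply: (ul [set y | mdist l y < e]).
by apply/nbhs_mdist_exP; exists e.
Qed.

(* Ultrafilters on [nat] replace the extraction of subsequences. *)
Section ultrafilter_limits.
Context {R : realType} {X : continuumType R} (U : set_system nat).
Context (UU : UltraFilter U).

Lemma ultra_cvg (u : nat -> X) : exists l : X, u i @[i --> U] --> l.
Proof.
have [|l [_ cl]] :=
  @continuum_compact R X (u i @[i --> U]) (fmap_proper_filter _ _).
  exact: filterT.
exists l => V lV; have [//|UnV] := in_ultra_setVsetC (u @^-1` V) UU.
by have [z [nVz Vz]] := cl (~` V) V UnV lV.
Qed.

Lemma ultra_pigeonhole (I : eqType) (s : seq I) (P : I -> set nat) :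
  U [set i | exists2 p, p \in s & P p i] -> exists2 p, p \in s & U (P p).
Proof.
move=> UP; apply: contrapT => nex.
have : U [set i | forall p, p \in s -> (~` P p) i].
  apply: filter_all_seq => p ps.
  by have [UPp|//] := in_ultra_setVsetC (P p) UU; case: nex; exists p.
by move=> /(filterI UP)/filter_ex[i [[p ps Pp] /(_ p ps)]].
Qed.

(** Plays the role of extracting a subsequence that tends to infinity or is constant. *)
Lemma ultra_bounded (k : nat -> nat) :
  (forall N, U [set i | (N <= k i)%N]) \/ exists c, U [set i | k i = c].
Proof.
have [|/existsNP[N nN]] := pselect (forall N, U [set i | (N <= k i)%N]).
  by left.
right; have [//|UN] := in_ultra_setVsetC [set i | (N <= k i)%N] UU.
have [|c _ Uc] := @ultra_pigeonhole _ (iota 0 N) (fun c => [set i | k i = c]).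
  apply: filterS UN => i /negP; rewrite -ltnNge => kN.
  by exists (k i) => //; rewrite mem_iota.
by exists c.
Qed.

Lemma ultra_cvg_unique (u v : nat -> X) (l m : X) :
  U [set i | u i = v i] ->
  u i @[i --> U] --> l -> v i @[i --> U] --> m -> l = m.
Proof.
move=> uv ul vm; apply/eqP; rewrite -(negbK (l == m)) -mdist_gt0; apply/negP.
move=> lm; have lm2 : 0 < mdist l m / 2 by rewrite divr_gt0.
near U => i; have uvi : u i = v i by near: i.
have h1 : mdist l (u i) < mdist l m / 2 by near: i; exact: cvg_mdist.
have h2 : mdist m (v i) < mdist l m / 2 by near: i; exact: cvg_mdist.
have := metric_triangle l (v i) m; rewrite (metric_sym (v i)) -uvi.
by move: h2; rewrite -uvi; lra.
Unshelve. all: by end_near. Qed.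

End ultrafilter_limits.

Lemma ultra_eventually : exists2 U : set_system nat,
  UltraFilter U & forall N, U [set i | (N <= i)%N].
Proof.
have [U [UU sub]] := ultraFilterLemma eventually_filter.
by exists U => // N; apply: sub; exists N.
Qed.

(** * Integer iterates of a homeomorphism *)

Definition ziter (T : topologicalType) (f : homeomorphism T) (k : int) :
    T -> T :=
  match k with
  | Posz n => iter n f
  | Negz n => iter n.+1 (homeo_inv f)
  end.

Arguments ziter : simpl never.

Definition homeo_sym (T : topologicalType) (f : homeomorphism T) :=
  Homeomorphism (@homeo_invK T f) (@homeo_funK T f)
    (@homeo_inv_continuous T f) (@homeo_fun_continuous T f).

Section ziter_theory.
Context {T : topologicalType} (f : homeomorphism T).

Lemma ziterS k x : ziter f (k + 1) x = f (ziter f k x).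
Proof.
case: k => [n|[|n]]; first by rewrite -PoszD addn1.
  by rewrite /= homeo_invK.
rewrite (_ : Negz n.+1 + 1 = Negz n); last by rewrite !NegzE; lia.
by rewrite /= [in RHS]homeo_invK.
Qed.

Lemma ziterP k x : ziter f (k - 1) x = homeo_inv f (ziter f k x).
Proof. by rewrite -{2}(subrK 1 k) ziterS homeo_funK. Qed.

Lemma ziterD a b x : ziter f (a + b) x = ziter f a (ziter f b x).
Proof.
elim/int_ind: a => [|n IH|n IH]; first by rewrite add0r.
  by rewrite -addn1 PoszD addrAC !ziterS IH.
by rewrite -addn1 PoszD opprD addrAC !ziterP IH.
Qed.

Lemma ziterC a b x : ziter f a (ziter f b x) = ziter f b (ziter f a x).
Proof. by rewrite -!ziterD addrC. Qed.

Lemma ziterK k x : ziter f (- k) (ziter f k x) = x.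
Proof. by rewrite -ziterD addNr. Qed.

Lemma ziterNK k x : ziter f k (ziter f (- k) x) = x.
Proof. by rewrite -ziterD addrN. Qed.

Lemma ziter_inj k : injective (ziter f k).
Proof. exact: can_inj (ziterK k). Qed.

Lemma iter_continuous (g : T -> T) n : continuous g -> continuous (iter n g).
Proof.
move=> gc; elim: n => [|n IH] x; first exact: cvg_id.
by apply: continuous_comp; [exact: IH|exact: gc].
Qed.

Lemma ziter_continuous k : continuous (ziter f k).
Proof.
case: k => n; apply: iter_continuous; first exact: homeo_fun_continuous.
exact: homeo_inv_continuous.
Qed.

Lemma ziter_opp (n : nat) : ziter f (- n%:Z) = iter n (homeo_inv f).
Proof. by case: n. Qed.

Lemma ziter_mul_fix (q n : nat) x :
  iter q f x = x -> ziter f (n * q)%N%:Z x = x.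
Proof.
move=> qx; elim: n => [//|n IH].
by rewrite mulSn PoszD ziterD IH.
Qed.

Definition aperiodic x := forall n, (0 < n)%N -> iter n f x <> x.

Lemma aperiodic_inj x : aperiodic x -> injective (ziter f ^~ x).
Proof.
move=> ax; suff H a b : a < b -> ziter f a x <> ziter f b x.
  move=> a b ab; case: (ltgtP a b) => // /H; first by rewrite ab.
  by rewrite ab.
move=> ab E; apply: (ax `|b - a|%N); first by rewrite absz_gt0 subr_eq0 gt_eqF.
have -> : iter `|b - a|%N f x = ziter f (b - a) x.
  by rewrite -[iter _ _ _]/(ziter f `|b - a|%N%:Z x) gez0_abs// subr_ge0 ltW.
by rewrite addrC ziterD -E ziterK.
Qed.

Lemma aperiodicN x : ~ aperiodic x -> exists2 n, (0 < n)%N & iter n f x = x.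
Proof.
move=> /existsNP[n /not_implyP[n0 /contrapT nx]]; by exists n.
Qed.

End ziter_theory.

Lemma ziter_sym (T : topologicalType) (f : homeomorphism T) k :
  ziter (homeo_sym f) k = ziter f (- k).
Proof. by case: k => [n|n]; rewrite ?ziter_opp// NegzE opprK. Qed.

(** * Limit sets *)

Section limit_sets.
Context {R : realType} {X : continuumType R}.
Implicit Types (f : homeomorphism X) (x y w : X).

Lemma omega_limitP (g : X -> X) y w : omega_limit_set g y w <->
  forall (e : R) N, 0 < e -> exists2 n, (N <= n)%N & mdist (iter n g y) w < e.
Proof.
rewrite omega_limit_setE; split=> [cw e N e0|h A B [N _ NA]].
  have gN : (iter n g y @[n --> \oo])
      [set iter n g y | n in [set n | N <= n]%N].
    by exists N => // n Nn; exists n.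
  have wB : nbhs w (ball w e) by exact: nbhsx_ballx.
  have [_ [[n Nn <-]]] := cw _ _ gN wB.
  by rewrite ballEmdist/= metric_sym; exists n.
move=> /nbhs_mdist_exP[e e0 eB]; have [n Nn nw] := h e N e0.
by exists (iter n g y); split; [exact: NA|apply: eB; rewrite metric_sym].
Qed.

Lemma omega_ziterP f y w : omega_limit_set f y w <->
  forall (e : R) N, 0 < e ->
  exists2 n : nat, (N <= n)%N & mdist (ziter f n%:Z y) w < e.
Proof. exact: omega_limitP. Qed.

Lemma alpha_ziterP f y w : alpha_limit_set f y w <->
  forall (e : R) N, 0 < e ->
  exists2 n : nat, (N <= n)%N & mdist (ziter f (- n%:Z) y) w < e.
Proof.
rewrite /alpha_limit_set omega_limitP.
split=> h e N e0; have [n] := h e N e0; exists n => //.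
  by rewrite ziter_opp.
by rewrite -ziter_opp.
Qed.

Lemma omega_sym f : omega_limit_set (homeo_sym f) = alpha_limit_set f.
Proof. by []. Qed.

Lemma alpha_sym f : alpha_limit_set (homeo_sym f) = omega_limit_set f.
Proof. by []. Qed.

Lemma closed_mdist (C : set X) w : closed C ->
  (forall e : R, 0 < e -> exists2 z, C z & mdist z w < e) -> C w.
Proof.
move=> cC h; apply: cC => B /nbhs_mdist_exP[e e0 eB].
have [z Cz zw] := h e e0.
by exists z; split=> //; apply: eB; rewrite metric_sym.
Qed.

Lemma ziter_mdist f k x (e : R) : 0 < e -> exists2 d : R, 0 < d &
  forall y, mdist x y < d -> mdist (ziter f k x) (ziter f k y) < e.
Proof.
move=> e0.
have : nbhs (ziter f k x) [set z | mdist (ziter f k x) z < e].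
  by apply/nbhs_mdist_exP; exists e.
by move=> /(ziter_continuous (k := k))/nbhs_mdist_exP.
Qed.

Lemma omega_ziter f k y : omega_limit_set f (ziter f k y) = omega_limit_set f y.
Proof.
suff H j z : omega_limit_set f z `<=` omega_limit_set f (ziter f j z).
  apply/seteqP; split=> w; last exact: H.
  by move=> /(H (- k)); rewrite ziterK.
move=> w /omega_ziterP h; apply/omega_ziterP => e N e0.
have [n Nn nw] := h e (N + `|j|)%N e0.
exists `|n%:Z - j|%N; first by lia.
by rewrite gez0_abs -?ziterD ?subrK//; lia.
Qed.

Lemma omega_invariant f k y w :
  omega_limit_set f y w -> omega_limit_set f y (ziter f k w).
Proof.
move=> /omega_ziterP h; rewrite -(omega_ziter f k).
apply/omega_ziterP => e N e0.
have [d d0 hd] := ziter_mdist f k w e0; have [n Nn nw] := h d N d0.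
by exists n => //; rewrite ziterC metric_sym; apply: hd; rewrite metric_sym.
Qed.

(** The limit set of [y] is closed and contains the whole two-sided orbit of [w]. The next three
    lemmas rest on the same argument. *)
Lemma omega_sub f y w : omega_limit_set f y w ->
  omega_limit_set f w `<=` omega_limit_set f y.
Proof.
move=> yw z /omega_ziterP wz; apply: closed_mdist.
  exact: omega_limit_set_closed.
move=> e e0; have [n _ nz] := wz e 0%N e0.
by exists (ziter f n%:Z w) => //; exact: omega_invariant.
Qed.

Lemma alpha_sub_omega f y w : omega_limit_set f y w ->
  alpha_limit_set f w `<=` omega_limit_set f y.
Proof.
move=> yw z /alpha_ziterP wz; apply: closed_mdist.
  exact: omega_limit_set_closed.
move=> e e0; have [n _ nz] := wz e 0%N e0.
by exists (ziter f (- n%:Z) w) => //; exact: omega_invariant.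
Qed.

Lemma alpha_sub f y w : alpha_limit_set f y w ->
  alpha_limit_set f w `<=` alpha_limit_set f y.
Proof. by rewrite -omega_sym => /omega_sub. Qed.

Lemma omega_sub_alpha f y w : alpha_limit_set f y w ->
  omega_limit_set f w `<=` alpha_limit_set f y.
Proof. by rewrite -omega_sym -(alpha_sym f) => /alpha_sub_omega. Qed.

Definition biasymptotic f x y := forall e : R, 0 < e ->
  exists N : nat, forall m : int, (N <= `|m|)%N ->
  mdist (ziter f m x) (ziter f m y) < e.

Lemma biasymptotic_sym f x y : biasymptotic f x y -> biasymptotic f y x.
Proof.
move=> h e e0; have [N hN] := h e e0; exists N => m Nm.
by rewrite metric_sym; exact: hN.
Qed.

Lemma biasymptotic_homeo_sym f x y :
  biasymptotic f x y -> biasymptotic (homeo_sym f) x y.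
Proof.
move=> h e e0; have [N hN] := h e e0; exists N => m Nm.
by rewrite ziter_sym; apply: hN; rewrite abszN.
Qed.

Lemma biasymptotic_omega f x y : biasymptotic f x y ->
  omega_limit_set f x = omega_limit_set f y.
Proof.
suff H a b : biasymptotic f a b ->
    omega_limit_set f a `<=` omega_limit_set f b.
  by move=> xy; apply/seteqP; split; apply: H => //; exact: biasymptotic_sym.
move=> ab w /omega_ziterP aw; apply/omega_ziterP => e N e0.
have e2 : 0 < e / 2 by rewrite divr_gt0.
have [M hM] := ab _ e2; have [n Nn nw] := aw _ (N + M)%N e2.
exists n; first by lia.
have := hM n%:Z; have := metric_triangle (ziter f n%:Z b) (ziter f n%:Z a) w.
rewrite (metric_sym _ (ziter f n%:Z a)) => h1 h2.
have : mdist (ziter f n%:Z a) (ziter f n%:Z b) < e / 2 by apply: h2; lia.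
lra.
Qed.

Lemma biasymptotic_alpha f x y : biasymptotic f x y ->
  alpha_limit_set f x = alpha_limit_set f y.
Proof.
move=> /biasymptotic_homeo_sym/biasymptotic_omega; exact.
Qed.

(** Iterates depend only on the exponent modulo [q], so the orbit is finite, hence closed, and each
    of its points recurs. *)
Lemma omega_fixed f q x : (0 < q)%N -> iter q f x = x ->
  omega_limit_set f x = [set ziter f n%:Z x | n in `I_q].
Proof.
move=> q0 qx.
have fin : finite_set [set ziter f n%:Z x | n in `I_q].
  exact/finite_image/finite_II.
have modE n : ziter f n%:Z x = ziter f (n %% q)%N%:Z x.
  by rewrite {1}(divn_eq n q) addnC PoszD ziterD ziter_mul_fix.
apply/seteqP; split=> w.
  move=> /omega_ziterP xw; apply: closed_mdist.
    apply: accessible_finite_set_closed.1 fin.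
    exact/hausdorff_accessible/metric_hausdorff.
  move=> e e0; have [n _ nw] := xw e 0%N e0; exists (ziter f n%:Z x) => //.
  by rewrite modE; exists (n %% q)%N => //; exact: ltn_pmod.
move=> [n _ <-]; apply: omega_invariant; apply/omega_ziterP => e N e0.
exists (N * q)%N; first by rewrite leq_pmulr.
by rewrite ziter_mul_fix// mdistxx.
Qed.

Lemma periodic_recurrent f q x : (0 < q)%N -> iter q f x = x ->
  omega_limit_set f x x.
Proof. by move=> q0 qx; rewrite (omega_fixed q0 qx); exists 0%N. Qed.

Lemma periodic_sym f q x : iter q f x = x -> iter q (homeo_inv f) x = x.
Proof.
move=> qx; rewrite -ziter_opp -{1}qx.
by rewrite -[iter q f x]/(ziter f q%:Z x) ziterK.
Qed.

Lemma omega_periodic_minimal f q x y z : (0 < q)%N -> iter q f x = x ->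
  omega_limit_set f x y -> omega_limit_set f y z <-> omega_limit_set f x z.
Proof.
move=> q0 qx; rewrite (omega_fixed q0 qx) => -[n _ <-].
by rewrite omega_ziter (omega_fixed q0 qx).
Qed.

Lemma omega_of_cvg f (U : set_system nat) (UU : UltraFilter U) (k : nat -> nat)
    y w : (forall N, U [set i | (N <= k i)%N]) ->
  ziter f (k i)%:Z y @[i --> U] --> w -> omega_limit_set f y w.
Proof.
move=> koo yw; apply/omega_ziterP => e N e0; near U => i; exists (k i).
  by near: i; exact: koo.
by rewrite metric_sym; near: i; exact: cvg_mdist.
Unshelve. all: by end_near. Qed.

Lemma alpha_of_cvg f (U : set_system nat) (UU : UltraFilter U) (k : nat -> nat)
    y w : (forall N, U [set i | (N <= k i)%N]) ->
  ziter f (- (k i)%:Z) y @[i --> U] --> w -> alpha_limit_set f y w.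
Proof.
move=> koo yw; rewrite -omega_sym; apply: (omega_of_cvg UU koo).
by under eq_fun do rewrite ziter_sym.
Qed.

Lemma cvg_ziter f (U : set_system nat) (u : nat -> X) k y :
  u i @[i --> U] --> y -> ziter f k (u i) @[i --> U] --> ziter f k y.
Proof. by move=> uy V /(ziter_continuous (k := k))/uy. Qed.

End limit_sets.

(** * Biasymptotic points and recurrence *)

(** Each value is chosen beyond the absolute value of the previous one. *)
Lemma unbounded_injective (P : int -> Prop) :
  (forall N, exists2 m, (N <= `|m|)%N & P m) ->
  exists h : nat -> int, injective h /\ forall n, P (h n).
Proof.
move=> /(_ _)/cid2-/all_sig2[g gN Pg].
pose h n := iter n (fun m => g `|m|.+1) (g 0%N).
have hP n : P (h n) by case: n => [|n]; exact: Pg.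
have hS n : (`|h n| < `|h n.+1|)%N by exact: gN.
exists h; split=> // i j hij.
have := homo_ltn ltn_trans hS.
have [ij|ij|//] := ltngtP i j => H; have := H _ _ ij; rewrite hij ltnn//.
Qed.

Lemma cvg_natSinv (R : realType) (X : metricType R) (U : set_system nat)
    (UU : UltraFilter U) (v : nat -> X) (y : X) :
  (forall N, U [set i | (N <= i)%N]) ->
  (forall i, mdist y (v i) < i.+1%:R^-1) -> v i @[i --> U] --> y.
Proof.
move=> Uoo vy V /nbhs_mdist_exP[e e0 eV].
have [N _ hN] := near_infty_natSinv_lt (PosNum e0).
apply: (@filterS _ U _ _ _ _ (Uoo N)) => i Ni /=.
by apply: eV; apply: lt_trans (vy i) _; exact: hN.
Qed.

Section regular_curve_dynamics.
Context {R : realType} {X : continuumType R}.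
Hypothesis hX : regular_curve X.
Implicit Types (f : homeomorphism X) (U : set_system nat).

(** Let [Q] be a small connected neighbourhood of [y]. Its image under [ziter f (k i)] contains a
    point inside [V] and one outside, so it meets the finite boundary; pulled back, that boundary
    point is near [y]. The ultrafilter selects one boundary point for all [i]. *)
Lemma cvg_connected_crossing f U (UU : UltraFilter U) (k : nat -> int)
    (u : nat -> X) y (V : set X) (s : seq X) :
  open V -> boundary V = [set` s] -> u i @[i --> U] --> y ->
  U [set i | V (ziter f (k i) y) <-> ~ V (ziter f (k i) (u i))] ->
  exists2 p, p \in s & ziter f (- k i) p @[i --> U] --> y.
Proof.
move=> oV bV uy UV; apply: contrapT => nex.
have /choice[B hB] : forall p, exists B, p \in s ->
    nbhs y B /\ ~ U [set i | B (ziter f (- k i) p)].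
  move=> p; case: (boolP (p \in s)) => [ps|]; last by exists setT.
  apply: contrapT => /forallNP nB; apply: nex; exists p => // B yB.
  by apply: contrapT => nUB; apply: (nB B) => _.
have : nbhs y [set z | forall p, p \in s -> B p z].
  by apply: filter_all_seq => p ps; have [] := hB p ps.
move=> /nbhs_mdist_exP[e e0 eB].
have [Q [Qc yQ Qe]] := regular_connected_nbhs hX y e0.
have : U [set i | exists2 p, p \in s & B p (ziter f (- k i) p)].
  have UQ : U [set i | Q (u i)] by exact: uy.
  apply: filterS2 UV UQ => i /= Vi Qu.
  have gc : connected (ziter f (k i) @` Q).
    apply: connected_continuous_connected => //.
    exact/continuous_subspaceT/ziter_continuous.
  have [p [q Qq qp]] : exists2 p, (ziter f (k i) @` Q) p & boundary V p.
    have [Vy|nVy] := pselect (V (ziter f (k i) y)).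
      apply: (connected_meets_boundary gc oV _ Vy _ (Vi.1 Vy)).
        by exists y => //; exact: nbhs_singleton.
      by exists (u i).
    have Vu : V (ziter f (k i) (u i)).
      by apply: contrapT => nVu; apply: nVy; exact: Vi.2.
    apply: (connected_meets_boundary gc oV _ Vu _ nVy); first by exists (u i).
    by exists y => //; exact: nbhs_singleton.
  rewrite bV => ps; exists p; first exact: ps.
  have <- : q = ziter f (- k i) p by rewrite -qp ziterK.
  by apply: eB => //; exact: Qe.
by move=> /(ultra_pigeonhole UU)[p ps UB]; have [] := hB p ps.
Qed.

(** Otherwise [w] and [w'] are [e] apart at infinitely many times [h n]. Then [ziter f (k i)]
    spreads the close pairs formed by the [h j]-th iterates of [y] and [u i] at least [e / 3] apart;
    as the orbit of [y] is injective, this contradicts [finite_spread]. *)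
Lemma cvg_biasymptotic f U (UU : UltraFilter U) (k : nat -> int)
    (u : nat -> X) y w w' :
  aperiodic f y -> u i @[i --> U] --> y ->
  ziter f (k i) (u i) @[i --> U] --> w -> ziter f (k i) y @[i --> U] --> w' ->
  biasymptotic f w w'.
Proof.
move=> ay uy kw kw' e e0; apply: contrapT => /forallNP nN.
have [h [hinj he]] : exists h : nat -> int, injective h /\
    forall n, e <= mdist (ziter f (h n) w) (ziter f (h n) w').
  apply: (@unbounded_injective
    (fun m => e <= mdist (ziter f m w) (ziter f m w'))) => N.
  apply: contrapT => nex; apply: (nN N).
  by move=> m Nm; rewrite ltNge; apply/negP => em; apply: nex; exists m.
have e3 : 0 < e / 3 by rewrite divr_gt0.
have [K hK] := finite_spread hX e3.
have [|d d0 hd] := hK (fun j => ziter f (h j) y).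
  by move=> i j /(aperiodic_inj ay)/hinj/val_inj.
near U => i.
have [|||j] := hd (ziter f (k i)) (fun j => ziter f (h j) (u i)).
- exact: ziter_continuous.
- exact: ziter_inj.
- near: i; apply: filter_forall => j.
  by apply: cvg_mdist => //; exact: cvg_ziter.
have : forall j : 'I_K, mdist (ziter f (h j) w)
    (ziter f (h j) (ziter f (k i) (u i))) < e / 3.
  near: i; apply: filter_forall => j.
  by apply: cvg_mdist => //; exact: cvg_ziter.
have : forall j : 'I_K, mdist (ziter f (h j) w')
    (ziter f (h j) (ziter f (k i) y)) < e / 3.
  near: i; apply: filter_forall => j.
  by apply: cvg_mdist => //; exact: cvg_ziter.
move=> /(_ j) h1 /(_ j) h2; rewrite (ziterC _ (k i)) (ziterC _ (k i) (h j)).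
set a := ziter f (h j) (ziter f (k i) y) in h1 *.
set b := ziter f (h j) (ziter f (k i) (u i)) in h2 *.
move=> ab; have := he j.
have := metric_triangle (ziter f (h j) w) b (ziter f (h j) w').
have := metric_triangle b a (ziter f (h j) w').
by rewrite (metric_sym b a) (metric_sym a (ziter f (h j) w')); lra.
Unshelve. all: by end_near. Qed.

(** The point [p] is on the boundary of a neighbourhood of [w'] that stays away from [w]. Now
    [cvg_biasymptotic] applies to the sequence [ziter f (- k i) p], whose images are constantly
    [p]. *)
Lemma cvg_separation f U (UU : UltraFilter U) (k : nat -> int)
    (u : nat -> X) y w w' :
  aperiodic f y -> u i @[i --> U] --> y ->
  ziter f (k i) (u i) @[i --> U] --> w -> ziter f (k i) y @[i --> U] --> w' ->
  w <> w' ->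
  exists2 p, biasymptotic f p w' & ziter f (- k i) p @[i --> U] --> y.
Proof.
move=> ay uy kw kw' ww'.
have e0 : 0 < mdist w' w / 2 by rewrite divr_gt0// mdist_gt0; exact/eqP/nesym.
have [V [s [oV Vw' Ve bV]]] := regular_nbhs hX w' e0.
have [|p ps py] := cvg_connected_crossing (f := f) (k := k) UU oV bV uy.
  near=> i; split=> [_ Vw|_].
    have := Ve _ (subset_closure Vw).
    have : mdist w (ziter f (k i) (u i)) < mdist w' w / 2.
      by near: i; exact: cvg_mdist.
    have := metric_triangle w' (ziter f (k i) (u i)) w.
    by rewrite (metric_sym (ziter f (k i) (u i)) w); lra.
  by near: i; apply: kw'; exact: open_nbhs_nbhs.
exists p => //; apply: (cvg_biasymptotic UU ay py _ kw').
under eq_fun do rewrite ziterNK.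
exact: cvg_cst.
Unshelve. all: by end_near. Qed.

(** If [k] is constant along [U], continuity forces [w = w']. Otherwise the point [p] of
    [cvg_separation] has [y] in its alpha-limit set, which it shares with [w']. *)
Lemma cvg_neq_alpha f U (UU : UltraFilter U) (k : nat -> nat)
    (u : nat -> X) y w w' :
  aperiodic f y -> u i @[i --> U] --> y ->
  ziter f (k i)%:Z (u i) @[i --> U] --> w ->
  ziter f (k i)%:Z y @[i --> U] --> w' ->
  w <> w' -> alpha_limit_set f w' y.
Proof.
move=> ay uy kw kw' ww'; have [koo|[c kc]] := ultra_bounded UU k.
  have [p pw' py] := cvg_separation UU ay uy kw kw' ww'.
  by rewrite -(biasymptotic_alpha pw'); exact: (alpha_of_cvg UU koo py).
case: ww'; transitivity (ziter f c%:Z y).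
  apply: (ultra_cvg_unique UU _ kw (cvg_ziter (k := c%:Z) uy)).
  by apply: filterS kc => i /= ->.
apply: esym; apply: (ultra_cvg_unique UU _ kw' (@cvg_cst _ _ _ _ _)).
by apply: filterS kc => i /= ->.
Qed.

(** Late returns are built in, so that return times can be chosen to tend to infinity. *)
Definition nonwandering f y := forall (e : R) N, 0 < e ->
  exists n a, [/\ (N <= n)%N, mdist y a < e & mdist y (ziter f n%:Z a) < e].

Lemma nonwandering_sym f y : nonwandering f y -> nonwandering (homeo_sym f) y.
Proof.
move=> h e N e0; have [n [a [Nn ya yna]]] := h e N e0.
by exists n, (ziter f n%:Z a); rewrite ziter_sym ziterK.
Qed.

Lemma nonwandering_omega f x y : omega_limit_set f x y -> nonwandering f y.
Proof.
move=> /omega_ziterP xy e N e0; have [n _ ny] := xy e 0%N e0.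
have [m Nm my] := xy e (n + N)%N e0.
exists (m - n)%N, (ziter f n%:Z x); rewrite !(metric_sym y) -ziterD.
by split=> //; [lia|rewrite (_ : _ + _ = m%:Z)//; lia].
Qed.

Lemma nonwandering_alpha f x y : alpha_limit_set f x y -> nonwandering f y.
Proof.
(* Destructing [f] makes [homeo_sym (homeo_sym f)] convertible to [f]. *)
by rewrite -omega_sym => /nonwandering_omega/nonwandering_sym; case: f.
Qed.

Lemma nonwandering_closed f : closed (nonwandering f).
Proof.
move=> y cy e N e0; have e2 : 0 < e / 2 by rewrite divr_gt0.
have [z [zn /=]] := cy _ (nbhsx_ballx y _ e2); rewrite ballEmdist/= => yz.
have [n [a [Nn za zna]]] := zn _ N e2; exists n, a; split=> //.
  by rewrite (le_lt_trans (metric_triangle y z a))// [e]splitr ltrD.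
by rewrite (le_lt_trans (metric_triangle y z _))// [e]splitr ltrD.
Qed.

(* If [y] is not recurrent, then nearby orbits cannot leave the orbit of [y]:
   otherwise [cvg_neq_alpha] puts [y] in the alpha-limit set of a point [w'] of
   the omega-limit set of [y]. *)
Lemma nonwandering_recurrent f y : nonwandering f y -> omega_limit_set f y y.
Proof.
move=> ny; apply: contrapT => nr.
have ay : aperiodic f y by move=> n n0 /(periodic_recurrent n0).
have /choice[ka hka] : forall i : nat, exists ka : nat * X, [/\ (i <= ka.1)%N,
    mdist y ka.2 < i.+1%:R^-1 & mdist y (ziter f ka.1%:Z ka.2) < i.+1%:R^-1].
  move=> i; have [|n [a h]] := ny i.+1%:R^-1 i; first by rewrite invr_gt0.
  by exists (n, a).
have [U UU Uoo] := ultra_eventually.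
pose k i := (ka i).1; pose u i := (ka i).2.
have koo N : U [set i | (N <= k i)%N].
  apply: filterS (Uoo N) => i /= Ni; have [ik _ _] := hka i.
  exact: leq_trans ik.
have [w' kw'] := ultra_cvg UU (fun i => ziter f (k i)%:Z y).
have yw' := omega_of_cvg UU koo kw'.
have uy : u i @[i --> U] --> y.
  by apply: (cvg_natSinv UU) => // i; have [] := hka i.
have kuy : ziter f (k i)%:Z (u i) @[i --> U] --> y.
  by apply: (cvg_natSinv UU) => // i; have [] := hka i.
have yw'N : y <> w' by move=> yw; rewrite -yw in yw'.
apply: nr; apply: (alpha_sub_omega yw').
exact: (cvg_neq_alpha UU ay uy kuy kw' yw'N).
Qed.

End regular_curve_dynamics.

(** * Continuity at aperiodic points *)

Section omega_continuity.
Context {R : realType} {X : continuumType R}.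
Implicit Types (f : homeomorphism X) (U : set_system nat) (x y z w : X).

Lemma cvg_close U (UU : UltraFilter U) (u v : nat -> X) y :
  (forall N, U [set i | (N <= i)%N]) ->
  u i @[i --> U] --> y -> (forall i, mdist (v i) (u i) < i.+1%:R^-1) ->
  v i @[i --> U] --> y.
Proof.
move=> Uoo uy vu V /nbhs_mdist_exP[e e0 eV].
have e2 : 0 < e / 2 by rewrite divr_gt0.
have [N _ hN] := near_infty_natSinv_lt (PosNum e2).
have UN := Uoo N; near U => i; suff : U [set i | V (v i)] by [].
near=> j; apply: eV.
have : mdist y (u j) < e / 2 by near: j; exact: cvg_mdist.
have : mdist (v j) (u j) < e / 2.
  by apply: lt_trans (vu j) _; apply: hN; near: j.
have := metric_triangle y (u j) (v j); rewrite (metric_sym (v j)); lra.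
Unshelve. all: by end_near. Qed.

Lemma closed_ultra U (UU : UltraFilter U) (C : set X) (u : nat -> X) y :
  closed C -> u i @[i --> U] --> y -> (forall i, C (u i)) -> C y.
Proof.
move=> cC uy Cu; apply: closed_mdist => // e e0; near U => i.
exists (u i) => //; rewrite metric_sym; near: i; exact: cvg_mdist.
Unshelve. all: by end_near. Qed.

Lemma hyperspace_eq (A B : hyperspace X) : (A : set X) = B -> A = B.
Proof.
case: A B => [A A0 cA] [B B0 cB] /= AB; subst B.
by congr Hyperspace; exact: Prop_irrelevance.
Qed.

Lemma eq_omega_limit f x y : omega_limit_set f x = omega_limit_set f y ->
  omega_limit f x = omega_limit f y.
Proof. by move=> xy; apply: hyperspace_eq. Qed.

(** The two hypotheses are upper and lower semicontinuity and control one excess each. If an excess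
    stays at least [e], choose points at distance at least [e / 2] from the other set; their limit
    contradicts the hypothesis. *)
Lemma hyperspace_ultra_cvg U (UU : UltraFilter U) (A : hyperspace X)
    (B : nat -> hyperspace X) :
  (forall u y, (forall i, (B i : set X) (u i)) -> u i @[i --> U] --> y ->
    (A : set X) y) ->
  (forall w e, (A : set X) w -> 0 < e ->
    U [set i | exists2 z, (B i : set X) z & mdist w z < e]) ->
  forall e, 0 < e -> U [set i | mdist A (B i) < e].
Proof.
move=> up low e e0; have e2 : 0 < e / 2 by rewrite divr_gt0.
have e4 : 0 < e / 4 by rewrite divr_gt0.
have far (C D : hyperspace X) : e <= excess C D ->
    exists2 c, (C : set X) c & e / 2 <= dist_to c D.
  move=> eCD; apply: contrapT => nex; suff : excess C D <= e / 2 by lra.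
  apply: excess_le => c Cc; rewrite leNgt; apply/negP => h; apply: nex.
  by exists c => //; exact: ltW.
have U1 : U [set i | excess A (B i) < e].
  have [//|Un] := in_ultra_setVsetC [set i | excess A (B i) < e] UU.
  have [a0 Aa0] := hyperspace_neq0 A.
  have /choice[a ha] : forall i, exists a, (A : set X) a /\
      (e <= excess A (B i) -> e / 2 <= dist_to a (B i)).
    move=> i; have [eAB|neAB] := pselect (e <= excess A (B i)).
      by have [c Ac h] := far _ _ eAB; exists c.
    by exists a0; split.
  have [b ab] := ultra_cvg UU a.
  have Ab : (A : set X) b.
    apply: (closed_ultra UU (@hyperspace_closed _ _ A) ab).
    by move=> i; have [] := ha i.
  have Ulow := low b _ Ab e4.
  have : U set0; last by move=> /filter_ex[].
  near=> i; have /negP : ~ excess A (B i) < e by near: i.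
  rewrite -leNgt => eAB; have [z Bz bz] :
    exists2 z, (B i : set X) z & mdist b z < e / 4 by near: i.
  have : mdist b (a i) < e / 4 by near: i; exact: cvg_mdist.
  have := (ha i).2 eAB; have := dist_to_le (a i) Bz.
  have := metric_triangle (a i) b z; rewrite (metric_sym (a i) b).
  move=> *; lra.
have U2 : U [set i | excess (B i) A < e].
  have [//|Un] := in_ultra_setVsetC [set i | excess (B i) A < e] UU.
  have /choice[a ha] : forall i, exists a, (B i : set X) a /\
      (e <= excess (B i) A -> e / 2 <= dist_to a A).
    move=> i; have [eAB|neAB] := pselect (e <= excess (B i) A).
      by have [c Bc h] := far _ _ eAB; exists c.
    by have [b0 Bb0] := hyperspace_neq0 (B i); exists b0; split.
  have [b ab] := ultra_cvg UU a.
  have Ab : (A : set X) b by apply: up ab => i; have [] := ha i.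
  have : U set0; last by move=> /filter_ex[].
  near=> i; have /negP : ~ excess (B i) A < e by near: i.
  rewrite -leNgt => eAB.
  have : mdist b (a i) < e / 2 by near: i; exact: cvg_mdist.
  have := (ha i).2 eAB; have := dist_to_le (a i) Ab.
  rewrite (metric_sym (a i)); move=> *; lra.
apply: filterS2 U1 U2 => i /= h1 h2.
by rewrite hyperspace_mdistE /hausdorff_dist gt_max h1 h2.
Unshelve. all: by end_near. Qed.

Lemma continuous_at_ultra (g : X -> hyperspace X) x :
  (forall U, UltraFilter U -> (forall N, U [set i | (N <= i)%N]) ->
    forall u : nat -> X, u i @[i --> U] --> x ->
    forall e, 0 < e -> U [set i | mdist (g x) (g (u i)) < e]) ->
  {for x, continuous g}.
Proof.
move=> h V /nbhs_mdist_exP[e e0 eV]; apply: contrapT => nV.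
have /choice[u hu] : forall i : nat, exists u,
    mdist x u < i.+1%:R^-1 /\ ~ V (g u).
  move=> i; apply: contrapT => nex; apply: nV; apply/nbhs_mdist_exP.
  exists i.+1%:R^-1; first by rewrite invr_gt0.
  by move=> u xu; apply: contrapT => nVu; apply: nex; exists u.
have [U UU Uoo] := ultra_eventually.
have ux : u i @[i --> U] --> x.
  by apply: (cvg_natSinv UU) => // i; have [] := hu i.
have /filter_ex[i xi] := h U UU Uoo u ux e e0.
by have [_] := hu i; apply; exact: eV.
Qed.

(** By compactness, iterates at later and later times that avoid the limit set would have a limit in
    it. *)
Lemma omega_attracts f x (e : R) : 0 < e -> exists N, forall n : nat,
  (N <= n)%N -> exists2 z, omega_limit_set f x z & mdist (ziter f n%:Z x) z < e.
Proof.
move=> e0; apply: contrapT => /forallNP nN.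
have /choice[k hk] : forall i : nat, exists n : nat, (i <= n)%N /\
    forall z, omega_limit_set f x z -> e <= mdist (ziter f n%:Z x) z.
  move=> i; have /existsNP[n /not_implyP[ni nz]] := nN i.
  exists n; split=> // z xz; rewrite leNgt; apply/negP => h; apply: nz.
  by exists z.
have [U UU Uoo] := ultra_eventually.
have [z kz] := ultra_cvg UU (fun i => ziter f (k i)%:Z x).
have xz : omega_limit_set f x z.
  apply: (omega_of_cvg UU _ kz) => N; apply: filterS (Uoo N) => i /= Ni.
  by apply: leq_trans Ni _; have [] := hk i.
near U => i; have [_ /(_ z xz)] := hk i.
rewrite leNgt => /negP; apply; rewrite metric_sym; near: i.
exact: cvg_mdist.
Unshelve. all: by end_near. Qed.

(** Some iterate of [y] is near [w], and the same iterate of [v i] is near that one and remains in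
    the limit set of [u i]. *)
Lemma omega_lower f U (UU : UltraFilter U) (u v : nat -> X) y w :
  (forall i, omega_limit_set f (u i) (v i)) -> v i @[i --> U] --> y ->
  omega_limit_set f y w -> forall e : R, 0 < e ->
  U [set i | exists2 z, omega_limit_set f (u i) z & mdist w z < e].
Proof.
move=> uv vy /omega_ziterP yw e e0; have e2 : 0 < e / 2 by rewrite divr_gt0.
have [m _ mw] := yw _ 0%N e2.
near=> i; exists (ziter f m%:Z (v i)); first exact: omega_invariant.
have : mdist (ziter f m%:Z y) (ziter f m%:Z (v i)) < e / 2.
  by near: i; apply: cvg_mdist => //; exact: cvg_ziter.
have := metric_triangle w (ziter f m%:Z y) (ziter f m%:Z (v i)).
by rewrite (metric_sym w (ziter f m%:Z y)); lra.
Unshelve. all: by end_near. Qed.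

Hypothesis hX : regular_curve X.

(** At times when [u i] is close to [v i], the iterates of [x] tend to some [w] biasymptotic to [y].
    As a limit of nonwandering points, [y] is recurrent, so it lies in the limit set of [w]. *)
Lemma omega_upper_aperiodic f U (UU : UltraFilter U) (u v : nat -> X) x y :
  (forall N, U [set i | (N <= i)%N]) -> aperiodic f x ->
  u i @[i --> U] --> x -> (forall i, omega_limit_set f (u i) (v i)) ->
  v i @[i --> U] --> y -> omega_limit_set f x y.
Proof.
move=> Uoo ax ux uv vy.
have /choice[k hk] : forall i : nat, exists k : nat, (i <= k)%N /\
    mdist (ziter f k%:Z (u i)) (v i) < i.+1%:R^-1.
  move=> i; have /omega_ziterP/(_ i.+1%:R^-1 i)[] := uv i.
    by rewrite invr_gt0.
  by move=> k; exists k.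
have ky : ziter f (k i)%:Z (u i) @[i --> U] --> y.
  by apply: (cvg_close UU Uoo vy) => i; have [] := hk i.
have [w kw] := ultra_cvg UU (fun i => ziter f (k i)%:Z x).
have xw : omega_limit_set f x w.
  apply: (omega_of_cvg UU _ kw) => N; apply: filterS (Uoo N) => i /= Ni.
  by apply: leq_trans Ni _; have [] := hk i.
apply: (omega_sub xw).
rewrite -(biasymptotic_omega (cvg_biasymptotic hX UU ax ux ky kw)).
apply: (nonwandering_recurrent hX).
apply: (closed_ultra UU (nonwandering_closed (f := f)) vy) => i.
exact: nonwandering_omega (uv i).
Qed.

(** At late times when [x] is close to [w], [u i] is close to a point [v i] of its limit set. The
    limit [y] of the [v i] is biasymptotic to the recurrent point [w], and [omega_lower] applies. *)
Lemma omega_lower_aperiodic f U (UU : UltraFilter U) (u : nat -> X) x w :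
  (forall N, U [set i | (N <= i)%N]) -> aperiodic f x ->
  u i @[i --> U] --> x -> omega_limit_set f x w -> forall e : R, 0 < e ->
  U [set i | exists2 z, omega_limit_set f (u i) z & mdist w z < e].
Proof.
move=> Uoo ax ux xw.
have /choice[kv hkv] : forall i : nat, exists kv : nat * X, [/\
    omega_limit_set f (u i) kv.2,
    mdist w (ziter f kv.1%:Z x) < i.+1%:R^-1 &
    mdist (ziter f kv.1%:Z (u i)) kv.2 < i.+1%:R^-1].
  move=> i; have i0 : 0 < i.+1%:R^-1 :> R by rewrite invr_gt0.
  have [N hN] := omega_attracts f (u i) i0.
  have /omega_ziterP/(_ _ N i0)[k Nk kw] := xw.
  by have [z uz kz] := hN k Nk; exists (k, z); rewrite metric_sym.
pose k i := (kv i).1; pose v i := (kv i).2.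
have uv i : omega_limit_set f (u i) (v i) by have [] := hkv i.
have [y vy] := ultra_cvg UU v.
have ky : ziter f (k i)%:Z (u i) @[i --> U] --> y.
  by apply: (cvg_close UU Uoo vy) => i; have [] := hkv i.
have kw : ziter f (k i)%:Z x @[i --> U] --> w.
  by apply: (cvg_natSinv UU) => // i; have [] := hkv i.
apply: (omega_lower UU uv vy).
rewrite (biasymptotic_omega (cvg_biasymptotic hX UU ax ux ky kw)).
exact: (nonwandering_recurrent hX (nonwandering_omega xw)).
Qed.

Lemma omega_continuous_aperiodic f x : aperiodic f x ->
  {for x, continuous (omega_limit f : X -> hyperspace X)}.
Proof.
move=> ax; apply: continuous_at_ultra => U UU Uoo u ux.
apply: (hyperspace_ultra_cvg UU) => [v y uv vy|w e xw e0].
  exact: (omega_upper_aperiodic UU Uoo ax ux uv vy).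
exact: (omega_lower_aperiodic UU Uoo ax ux xw e0).
Qed.

Lemma omega_alpha_of_continuous f :
  continuous (omega_limit f : X -> hyperspace X) ->
  forall x, omega_limit_set f x = alpha_limit_set f x.
Proof.
move=> oc x.
(* The map [omega_limit f] is constant on the backward orbit of [x], which accumulates at [y]. *)
have xy y : alpha_limit_set f x y ->
    omega_limit_set f y = omega_limit_set f x.
  move=> /alpha_ziterP xy; suff : omega_limit f y = omega_limit f x.
    by move=> /(congr1 (@hyperspace_set _ _)).
  apply/eqP; rewrite -(negbK (_ == _)) -mdist_gt0; apply/negP => e0.
  set e := mdist _ _ in e0.
  have : nbhs (omega_limit f y) [set A | mdist (omega_limit f y) A < e].
    by apply/nbhs_mdist_exP; exists e.
  move=> /oc/nbhs_mdist_exP[d d0 hd]; have [n _ ny] := xy d 0%N d0.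
  have /= := hd (ziter f (- n%:Z) x); rewrite metric_sym ny => /(_ isT).
  by rewrite (eq_omega_limit (omega_ziter f _ x)) ltxx.
apply/seteqP; split=> y.
  have [z xz] := omega_limit_set_neq0 (homeo_inv f) x.
  by rewrite -(xy z xz); exact: omega_sub_alpha.
move=> ay; rewrite -(xy y ay).
exact: (nonwandering_recurrent hX (nonwandering_alpha ay)).
Qed.

End omega_continuity.

(** * Limit sets containing a periodic point *)

Section dist_to_theory.
Context {R : realType} {X : continuumType R}.
Implicit Types (x y z : X) (B : hyperspace X) (U : set_system nat).

Lemma dist_to_lipschitz x y B : dist_to x B <= mdist x y + dist_to y B.
Proof.
apply/ler_addgt0Pr => e e0.
have [b Bb yb] : exists2 b, (B : set X) b & mdist y b < dist_to y B + e.
  by apply: dist_to_lt; lra.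
have := dist_to_le x Bb; have := metric_triangle x y b; lra.
Qed.

Lemma dist_to_mem x B : (B : set X) x -> dist_to x B = 0.
Proof.
move=> Bx; apply/eqP; rewrite eq_le dist_to_ge0 andbT.
by have := dist_to_le x Bx; rewrite mdistxx.
Qed.

Lemma dist_to_gt0 x B : ~ (B : set X) x -> 0 < dist_to x B.
Proof.
move=> nBx; rewrite lt_neqAle dist_to_ge0 andbT; apply/negP => /eqP x0.
apply: nBx; apply: closed_mdist; first exact: hyperspace_closed.
move=> e e0; have [|b Bb xb] := @dist_to_lt R X x B e; first by rewrite -x0.
by exists b => //; rewrite metric_sym.
Qed.

Lemma cvg_dist_to_ge U (UU : UltraFilter U) (u : nat -> X) x B (r : R) :
  u i @[i --> U] --> x -> U [set i | r <= dist_to (u i) B] ->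
  r <= dist_to x B.
Proof.
move=> ux Ur; apply/ler_addgt0Pr => e e0; near U => i.
have ri : r <= dist_to (u i) B by near: i.
have : mdist x (u i) < e by near: i; exact: cvg_mdist.
by have := dist_to_lipschitz (u i) x B; rewrite (metric_sym (u i)); lra.
Unshelve. all: by end_near. Qed.

Lemma cvg_dist_to_le U (UU : UltraFilter U) (u : nat -> X) x B (r : R) :
  u i @[i --> U] --> x -> U [set i | dist_to (u i) B <= r] ->
  dist_to x B <= r.
Proof.
move=> ux Ur; apply/ler_addgt0Pr => e e0; near U => i.
have ri : dist_to (u i) B <= r by near: i.
have : mdist x (u i) < e by near: i; exact: cvg_mdist.
by have := dist_to_lipschitz x (u i) B; lra.
Unshelve. all: by end_near. Qed.

End dist_to_theory.

Lemma multiple_between (n q : nat) : (0 < q)%N ->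
  exists m, (n <= m * q <= n + q)%N.
Proof.
move=> q0; exists (n %/ q).+1; rewrite mulSn.
by have := divn_eq n q; have := ltn_pmod n q0; lia.
Qed.

(** * Visits to a recurrent point and exits from balls around its limit set *)

Section near_a_recurrent_point.
Context {R : realType} {X : continuumType R}.
Variables (f : homeomorphism X) (x : X).
Hypothesis rx : omega_limit_set f x x.
Local Notation O := (omega_limit f x).

(** A close enough visit to [x] is followed by [L] steps close to the orbit of [x], which lies in
    [O]. *)
Lemma omega_stays_near y (e : R) (N L : nat) :
  omega_limit_set f y x -> 0 < e ->
  exists2 n : nat, (N <= n)%N &
  forall m : nat, (n <= m <= n + L)%N -> dist_to (ziter f m%:Z y) O < e.
Proof.
move=> /omega_ziterP yx e0.
have [d d0 hd] : exists2 d : R, 0 < d & forall (j : 'I_L.+1) z,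
    mdist x z < d -> mdist (ziter f j%:Z x) (ziter f j%:Z z) < e.
  apply: common_radius => [j d d' d'0 d'd h z xz|j].
    by apply: h; exact: lt_le_trans d'd.
  exact: ziter_mdist.
have [n Nn nx] := yx d N d0; exists n => // m /andP[nm mL].
have jL : (m - n < L.+1)%N by lia.
have := hd (Ordinal jL) (ziter f n%:Z y); rewrite metric_sym => /(_ nx)/=.
rewrite -ziterD -PoszD subnK// metric_sym; apply: le_lt_trans.
by apply: (@dist_to_le R X _ O); exact: omega_invariant.
Qed.

(** Let [k i] be the first exit time. It is unbounded, since at a fixed time the iterates of [u i]
    tend to a point of [O]. Before the exit the distance is below [r], which passes to the backward
    iterates of the limit [v]. *)
Lemma first_exit (U : set_system nat) (UU : UltraFilter U) (u : nat -> X)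
    (r : R) : u i @[i --> U] --> x -> 0 < r ->
  U [set i | exists k : nat, r <= dist_to (ziter f k%:Z (u i)) O] ->
  exists (k : nat -> nat) (v : X), [/\ forall N, U [set i | (N <= k i)%N],
    ziter f (k i)%:Z (u i) @[i --> U] --> v, r <= dist_to v O &
    forall j : nat, (0 < j)%N -> dist_to (ziter f (- j%:Z) v) O <= r].
Proof.
move=> ux r0 Ur.
have /choice[k hk] : forall i, exists k : nat,
    (exists k : nat, r <= dist_to (ziter f k%:Z (u i)) O) ->
    r <= dist_to (ziter f k%:Z (u i)) O /\
    forall m : nat, (m < k)%N -> dist_to (ziter f m%:Z (u i)) O < r.
  move=> i; have [exk|nex] := pselect (exists k : nat,
    r <= dist_to (ziter f k%:Z (u i)) O); last by exists 0%N.
  case: (ex_minnP exk) => k rk kmin; exists k => _; split=> // m mk.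
  by rewrite ltNge; apply/negP => /kmin; rewrite leqNgt mk.
have Uk : U [set i | r <= dist_to (ziter f (k i)%:Z (u i)) O].
  by apply: filterS Ur => i /hk[].
have [v kv] := ultra_cvg UU (fun i => ziter f (k i)%:Z (u i)).
have koo : forall N, U [set i | (N <= k i)%N].
  have [//|[c kc]] := ultra_bounded UU k.
  suff : r <= dist_to (ziter f c%:Z x) O.
    rewrite dist_to_mem; last exact: omega_invariant.
    by rewrite leNgt r0.
  apply: (cvg_dist_to_ge UU (cvg_ziter (k := c%:Z) ux)).
  by apply: filterS2 Uk kc => i /= + <-.
exists k, v; split=> //; first exact: (cvg_dist_to_ge UU kv).
move=> j j0; apply: (cvg_dist_to_le UU (cvg_ziter (k := - j%:Z) kv)).
apply: filterS2 Ur (koo j) => i /hk[_ /(_ (k i - j)%N)] + /= jk.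
rewrite -ziterD (_ : - j%:Z + k i = (k i - j)%N%:Z); last lia.
by move=> h; apply/ltW/h; lia.
Qed.

(** A periodic point is one of its own backward iterates, so both bounds apply to [v]. *)
Lemma periodic_exit v (r : R) : ~ aperiodic f v -> r <= dist_to v O ->
  (forall j : nat, (0 < j)%N -> dist_to (ziter f (- j%:Z) v) O <= r) ->
  dist_to v O = r.
Proof.
move=> /aperiodicN[n n0 nv] rv /(_ n n0); rewrite ziter_opp periodic_sym//.
by move=> vr; apply/eqP; rewrite eq_le vr.
Qed.

Hypothesis hX : regular_curve X.

(* Periodic points on many spheres around [O] stay in place under a common
   power of [f], while the points of [A] next to them are sent near [O]. *)
Lemma periodic_spheres_absurd (A : set X) (r0 : R) : 0 < r0 ->
  (forall r, 0 < r -> r < r0 -> exists v,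
    [/\ ~ aperiodic f v, dist_to v O = r & closure A v]) ->
  (forall (K : nat) (a : 'I_K -> X) (Q : nat), (forall j, A (a j)) ->
    (0 < Q)%N -> exists n : nat,
    forall j, dist_to (ziter f (n * Q)%N%:Z (a j)) O < r0 / 4) ->
  False.
Proof.
move=> r00 HA Hn; have r4 : 0 < r0 / 4 by rewrite divr_gt0.
have [K hK] := finite_spread hX r4.
(* These are [K] distinct radii strictly between [r0 / 2] and [r0]. *)
pose r (j : 'I_K) : R := r0 / 2 + r0 / 2 * (j.+1%:R / K.+1%:R).
have K0 : 0 < K.+1%:R :> R by rewrite ltr0n.
have rj j : r0 / 2 < r j /\ r j < r0.
  have h1 : 0 < j.+1%:R / K.+1%:R :> R by rewrite divr_gt0.
  have h2 : j.+1%:R / K.+1%:R < 1 :> R.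
    by rewrite ltr_pdivrMr// mul1r ltr_nat ltnS.
  rewrite /r; set t := _ / K.+1%:R in h1 h2 *.
  by split; nra.
have /choice[v hv] : forall j, exists v,
    [/\ ~ aperiodic f v, dist_to v O = r j & closure A v].
  by move=> j; have [h1 h2] := rj j; apply: HA => //; lra.
have [|d d0 hd] := hK v.
  move=> i j vij; have [_ ri _] := hv i; have [_ rj' _] := hv j.
  have : r i = r j by rewrite -ri -rj' vij.
  move=> /addrI/mulfI; rewrite gt_eqF ?divr_gt0// => /(_ isT).
  move=> /divIf; rewrite gt_eqF// => /(_ isT) /eqP.
  by rewrite eqr_nat eqSS => /eqP/val_inj.
have /choice[q hq] : forall j, exists q, (0 < q)%N /\ iter q f (v j) = v j.
  by move=> j; have [/aperiodicN[q q0 qv] _ _] := hv j; exists q.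
have /choice[a ha] : forall j, exists a, A a /\ mdist (v j) a < d.
  move=> j; have [_ _ clv] := hv j.
  have [a [Aa]] := clv _ (nbhsx_ballx (v j) d d0).
  by rewrite ballEmdist; exists a.
pose Q := (\prod_(j < K) q j)%N.
have Q0 : (0 < Q)%N by apply: prodn_gt0 => j; have [] := hq j.
have [|n hn] := Hn K a Q _ Q0; first by move=> j; have [] := ha j.
(* This power fixes [v j], at distance more than [r0 / 2] from [O], and sends [a j] within [r0 / 4]
   of [O]; so no pair ends up within [r0 / 4]. *)
have [|||j] := hd (ziter f (n * Q)%N%:Z) a.
- exact: ziter_continuous.
- exact: ziter_inj.
- by move=> j; have [] := ha j.
have -> : ziter f (n * Q)%N%:Z (v j) = v j.
  by rewrite /Q (bigD1 j)//= mulnCA mulnC ziter_mul_fix//; have [] := hq j.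
have := hn j; have := dist_to_lipschitz (v j) (ziter f (n * Q)%N%:Z (a j)) O.
have [_ -> _] := hv j; have [h1 _] := rj j; lra.
Qed.

End near_a_recurrent_point.

Section minimality.
Context {R : realType} {X : continuumType R}.
Hypothesis hX : regular_curve X.
Variables (f : homeomorphism X) (x : X) (q : nat).
Hypotheses (q0 : (0 < q)%N) (qx : iter q f x = x).
Local Notation O := (omega_limit f x).

Let rx : omega_limit_set f x x := periodic_recurrent q0 qx.

(* Orbits near [y] follow the orbit of [y] when it comes close to [O], by
   [cvg_neq_alpha]. *)
Lemma shadowing_near_orbit y (e : R) :
  aperiodic f y -> ~ omega_limit_set f x y -> 0 < e ->
  exists2 d : R, 0 < d & forall (k : nat) z,
  dist_to (ziter f k%:Z y) O < d -> mdist y z < d ->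
  dist_to (ziter f k%:Z z) O < e.
Proof.
move=> ay nxy e0; apply: contrapT => nex.
have /choice[kz hkz] : forall i : nat, exists kz : nat * X, [/\
    dist_to (ziter f kz.1%:Z y) O < i.+1%:R^-1, mdist y kz.2 < i.+1%:R^-1 &
    e <= dist_to (ziter f kz.1%:Z kz.2) O].
  move=> i; apply: contrapT => nkz; apply: nex; exists i.+1%:R^-1.
    by rewrite invr_gt0.
  move=> k z h1 h2; rewrite ltNge; apply/negP => h3; apply: nkz.
  by exists (k, z).
pose k i := (kz i).1; pose z i := (kz i).2.
have [U UU Uoo] := ultra_eventually.
have [w kw] := ultra_cvg UU (fun i => ziter f (k i)%:Z (z i)).
have [w' kw'] := ultra_cvg UU (fun i => ziter f (k i)%:Z y).
have zy : z i @[i --> U] --> y.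
  by apply: (cvg_natSinv UU) => // i; have [] := hkz i.
have we : e <= dist_to w O.
  apply: (cvg_dist_to_ge UU kw); apply: filterS filterT => i _.
  by have [] := hkz i.
have xw' : omega_limit_set f x w'.
  apply: contrapT => /(@dist_to_gt0 R X _ O) w'0.
  suff : dist_to w' O <= dist_to w' O / 2 by lra.
  apply: (cvg_dist_to_le UU kw').
  have w'2 : 0 < dist_to w' O / 2 by rewrite divr_gt0.
  have [N _ hN] := near_infty_natSinv_lt (PosNum w'2).
  apply: filterS (Uoo N) => i Ni; have [ki _ _] := hkz i.
  by apply/ltW/(lt_trans ki)/hN.
apply: nxy; apply: (alpha_sub_omega xw').
apply: (cvg_neq_alpha hX UU ay zy kw kw') => ww'; move: we.
by rewrite ww' dist_to_mem// leNgt e0.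
Qed.

(* [v] is the limit of the first returns of [y] to a ball after longer and
   longer absences near [O]. *)
Lemma periodic_near_recurrent y (e : R) :
  omega_limit_set f y y -> omega_limit_set f y x ->
  0 < e -> e < dist_to y O ->
  exists2 v, ~ aperiodic f v & mdist y v <= e.
Proof.
move=> ry yx e0 ey.
have /choice[n hn] : forall i : nat, exists n : nat, [/\ (i <= n)%N,
    mdist y (ziter f n%:Z y) < e &
    forall j : nat, (0 < j <= i)%N -> e <= mdist y (ziter f (n%:Z - j%:Z) y)].
  move=> i; have ey' : 0 < dist_to y O - e by lra.
  (* A point within [dist_to y O - e] of [O] is more than [e] away from [y], so the first return
     after [n] follows an absence of at least [i] steps. *)
  have [n in_ nfar] := omega_stays_near rx i i yx ey'.
  have exm : exists m, (n <= m)%N && (mdist y (ziter f m%:Z y) < e).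
    have /omega_ziterP/(_ e n e0)[m nm my] := ry.
    by exists m; rewrite nm metric_sym.
  case: (ex_minnP exm) => m /andP[nm my] mmin.
  have mi : (n + i < m)%N.
    rewrite ltnNge; apply/negP => mi; have /nfar : (n <= m <= n + i)%N by lia.
    by have := dist_to_lipschitz y (ziter f m%:Z y) O; lra.
  exists m; split=> //; first lia.
  move=> j /andP[j0 ji]; rewrite (_ : m%:Z - j%:Z = (m - j)%N%:Z); last lia.
  rewrite leNgt; apply/negP => h.
  have := mmin (m - j)%N; rewrite h andbT => h'.
  suff : (m <= m - j)%N by lia.
  by apply: h'; lia.
have [U UU Uoo] := ultra_eventually.
have noo N : U [set i | (N <= n i)%N].
  by apply: filterS (Uoo N) => i /= Ni; have [+ _ _] := hn i; exact: leq_trans.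
have [v nv] := ultra_cvg UU (fun i => ziter f (n i)%:Z y).
exists v; last first.
  apply/ler_addgt0Pr => r r0; near U => i.
  have : mdist v (ziter f (n i)%:Z y) < r by near: i; exact: cvg_mdist.
  have [_ + _] := hn i; have := metric_triangle y (ziter f (n i)%:Z y) v.
  by rewrite (metric_sym (ziter f (n i)%:Z y) v); lra.
(* If [v] is aperiodic, running time backwards makes [y] biasymptotic to a point [w'] of the
   alpha-limit set of [v]. As [y] is also backward recurrent, it belongs to that set, although the
   backward iterates of [v] avoid it. *)
move=> av; have far j : (0 < j)%N -> e <= mdist y (ziter f (- j%:Z) v).
  move=> j0; apply/ler_addgt0Pr => r r0; near U => i.
  have : mdist (ziter f (- j%:Z) v) (ziter f (- j%:Z) (ziter f (n i)%:Z y)) < r.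
    by near: i; apply: cvg_mdist => //; exact: cvg_ziter.
  have ji : (j <= i)%N by near: i; exact: Uoo.
  have [_ _ /(_ j)] := hn i; rewrite j0 ji => /(_ isT).
  rewrite -ziterD (addrC (- _)).
  have := metric_triangle y (ziter f (- j%:Z) v) (ziter f ((n i)%:Z - j%:Z) y).
  lra.
have [w' nw'] := ultra_cvg UU (fun i => ziter f (- (n i)%:Z) v).
have vw' := alpha_of_cvg UU noo nw'.
have ny : ziter f (- (n i)%:Z) (ziter f (n i)%:Z y) @[i --> U] --> y.
  by under eq_fun do rewrite ziterK; exact: cvg_cst.
have yw' := cvg_biasymptotic hX UU av nv ny nw'.
have ay : alpha_limit_set f y y.
  have := nonwandering_sym (nonwandering_omega ry).
  by move=> /(nonwandering_recurrent hX).
rewrite (biasymptotic_alpha yw') in ay.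
have /alpha_ziterP/(_ e 1%N e0)[j j0] := alpha_sub vw' ay.
by rewrite metric_sym ltNge far.
Unshelve. all: by end_near. Qed.

(** For aperiodic [y] outside [O], a nearby periodic point [v] follows [y] towards [O]. While [y]
    stays near [O] for a full period of [v], some multiple of that period occurs, so [v] itself is
    near [O], yet it is near [y]. *)
Lemma recurrent_periodic_limit y :
  omega_limit_set f y y -> omega_limit_set f y x -> omega_limit_set f x y.
Proof.
move=> ry yx; apply: contrapT => nxy.
have y0 : 0 < dist_to y O by exact: dist_to_gt0.
have [ay|/aperiodicN[n n0 ny]] := pselect (aperiodic f y); last first.
  by apply: nxy; apply/(omega_periodic_minimal _ n0 ny yx).
have e0 : 0 < dist_to y O / 3 by rewrite divr_gt0.
have [d d0 hd] := shadowing_near_orbit ay nxy e0.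
have [||v /aperiodicN[n n0 nv] yv] :=
    @periodic_near_recurrent y (Num.min (d / 2) (dist_to y O / 3)) ry yx.
- by rewrite lt_min e0 divr_gt0.
- by rewrite gt_min; apply/orP; right; lra.
have [m _ near_m] := omega_stays_near rx 0 n yx d0.
have [k /near_m kd] := multiple_between m n0.
move: yv; rewrite le_min => /andP[yvd yve].
have yd : mdist y v < d by lra.
have := hd _ v kd yd; rewrite ziter_mul_fix//.
by have := dist_to_lipschitz y v O; lra.
Qed.

(** If the limit set of [y] leaves [O], exits of the orbit of [y] after visits near [x] accumulate
    at periodic points on every small sphere around [O]. The orbit of [y] approximates them and
    makes long stays near [O], against [periodic_spheres_absurd]. *)
Lemma omega_periodic_limit y :
  omega_limit_set f y x -> omega_limit_set f y = omega_limit_set f x.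
Proof.
move=> yx; apply/seteqP; split; last exact: omega_sub.
move=> w yw; apply: contrapT => nxw.
have w0 : 0 < dist_to w O by exact: dist_to_gt0.
have [U UU Uoo] := ultra_eventually.
have ge_oo (k : nat -> nat) :
    (forall i, (i <= k i)%N) -> forall N, U [set i | (N <= k i)%N].
  by move=> hk N; apply: filterS (Uoo N) => i /= Ni; exact: leq_trans Ni (hk i).
have /choice[n hn] : forall i : nat, exists n : nat,
    (i <= n)%N /\ mdist x (ziter f n%:Z y) < i.+1%:R^-1.
  move=> i; have /omega_ziterP/(_ i.+1%:R^-1 i)[] := yx.
    by rewrite invr_gt0.
  by move=> n; exists n; rewrite metric_sym.
have nx : ziter f (n i)%:Z y @[i --> U] --> x.
  by apply: (cvg_natSinv UU) => // i; have [] := hn i.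
(* An aperiodic [v] would have [x] in its limit set, by following the orbit of [y] from near [v] to
   near [x]; then [recurrent_periodic_limit] puts [v] in [O]. *)
have per v : omega_limit_set f y v -> ~ omega_limit_set f x v ->
    ~ aperiodic f v.
  move=> yv nxv av; apply: nxv.
  have rv := nonwandering_recurrent hX (nonwandering_omega yv).
  apply: recurrent_periodic_limit => //.
  have /choice[m hm] : forall i : nat, exists m : nat,
      mdist v (ziter f m%:Z y) < i.+1%:R^-1.
    move=> i; have /omega_ziterP/(_ i.+1%:R^-1 0%N)[] := yv.
      by rewrite invr_gt0.
    by move=> m; exists m; rewrite metric_sym.
  have mv : ziter f (m i)%:Z y @[i --> U] --> v.
    by apply: (cvg_natSinv UU) => // i; exact: hm.
  (* The shift by [m i] guarantees [N i - m i >= i]. *)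
  pose N i := n (m i + i)%N.
  have Nx : ziter f ((N i - m i)%N%:Z) (ziter f (m i)%:Z y) @[i --> U] --> x.
    apply: (cvg_natSinv UU) => // i; rewrite -ziterD -PoszD subnK.
      have [_ h] := hn (m i + i)%N; apply: (lt_le_trans h).
      by rewrite lef_pV2 ?posrE// ler_nat ltnS leq_addl.
    by have [h _] := hn (m i + i)%N; rewrite /N; lia.
  have [w' Nw'] := ultra_cvg UU (fun i => ziter f ((N i - m i)%N%:Z) v).
  have xw' := cvg_biasymptotic hX UU av mv Nx Nw'.
  have vw' : omega_limit_set f v w'.
    apply: (omega_of_cvg UU _ Nw'); apply: ge_oo => i.
    by have [h _] := hn (m i + i)%N; rewrite /N; lia.
  by apply: (omega_sub vw'); rewrite -(biasymptotic_omega xw').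
apply: (@periodic_spheres_absurd R X f x hX
  [set ziter f n%:Z y | n in [set: nat]] (dist_to w O))
  => // [r r0 rw|K a Q Aa Q0].
  have [|k [v [koo kv rv vr]]] := first_exit rx UU nx r0.
    apply: filterS filterT => i _.
    have wr : 0 < dist_to w O - r by lra.
    have /omega_ziterP/(_ _ (n i) wr)[m nm mw] := yw.
    exists (m - n i)%N; rewrite -ziterD -PoszD subnK//.
    have := dist_to_lipschitz w (ziter f m%:Z y) O; rewrite (metric_sym w).
    lra.
  have yv : omega_limit_set f y v.
    apply: (@omega_of_cvg R X f U UU (fun i => k i + n i)%N).
      move=> N; apply: filterS (koo N) => i /= ; lia.
    by under eq_fun do rewrite PoszD ziterD.
  have nxv : ~ omega_limit_set f x v.
    by move=> /(@dist_to_mem R X _ O) v0; lra.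
  exists v; split; first exact: per.
    by apply: periodic_exit => //; exact: per.
  move=> B /nbhs_mdist_exP[e e0 eB].
  have /omega_ziterP/(_ e 0%N e0)[m _ mv] := yv.
  exists (ziter f m%:Z y); split; first by exists m.
  by apply: eB; rewrite metric_sym.
have /choice[m hm] : forall j, exists m : nat, ziter f m%:Z y = a j.
  by move=> j; have [m _ mj] := Aa j; exists m.
pose M := \max_(j < K) m j.
have w4 : 0 < dist_to w O / 4 by rewrite divr_gt0.
(* The length [Q] leaves room for a multiple of [Q], and [M] for the offsets [m j]. *)
have [p _ hp] := omega_stays_near rx 0 (Q + M) yx w4.
have [t ht] := multiple_between p Q0.
exists t => j; rewrite -hm -ziterD -PoszD; apply: hp.
have : (m j <= M)%N by exact: leq_bigmax.
lia.
Qed.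

(* A discontinuity at the periodic point [x] yields orbits that start near [x]
   and leave the balls around [O]; their exit points are periodic and are
   limits of points homoclinic to [O]. *)
Lemma omega_continuous_periodic :
  (forall z, omega_limit_set f z = alpha_limit_set f z) ->
  {for x, continuous (omega_limit f : X -> hyperspace X)}.
Proof.
move=> oa; apply: continuous_at_ultra => U UU Uoo u ux.
have up (v : nat -> X) y : (forall i, omega_limit_set f (u i) (v i)) ->
    v i @[i --> U] --> y -> omega_limit_set f x y.
  move=> uv vy; apply: contrapT => nxy.
  have y0 : 0 < dist_to y O by exact: dist_to_gt0.
  apply: (@periodic_spheres_absurd R X f x hX
    [set p | omega_limit_set f p = omega_limit_set f x] (dist_to y O))
    => // [r r0 ry|K a Q Aa Q0]; last first.
    have y4 : 0 < dist_to y O / 4 by rewrite divr_gt0.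
    have /choice[N hN] := fun j => omega_attracts f (a j) y4.
    exists (\max_(j < K) N j) => j.
    have [|z az] := hN j ((\max_(j < K) N j) * Q)%N.
      by apply: leq_trans (leq_pmulr _ Q0); exact: leq_bigmax.
    apply: le_lt_trans; apply: (@dist_to_le R X _ O).
    by move: az; rewrite Aa.
  have [|k [c [koo kc rc cr]]] := first_exit rx UU ux r0.
    have yr : 0 < (dist_to y O - r) / 2 by lra.
    near=> i; have : mdist y (v i) < (dist_to y O - r) / 2.
      by near: i; exact: cvg_mdist.
    have /omega_ziterP/(_ _ 0%N yr)[k _ kv] := uv i.
    move=> yv; exists k; have := dist_to_lipschitz y (ziter f k%:Z (u i)) O.
    have := metric_triangle y (v i) (ziter f k%:Z (u i)).
    by rewrite (metric_sym (v i)); lra.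
  (* Otherwise [x] is in the alpha-limit set of [c], which is also its omega-limit set and so equals
     [O]; upper semicontinuity at the aperiodic point [c] then puts [y] in [O]. *)
  have pc : ~ aperiodic f c.
    move=> ac; have [w' kw'] := ultra_cvg UU (fun i => ziter f (- (k i)%:Z) c).
    have cw' := alpha_of_cvg UU koo kw'.
    have kx : ziter f (- (k i)%:Z) (ziter f (k i)%:Z (u i)) @[i --> U] --> x.
      by under eq_fun do rewrite ziterK.
    have xw' := cvg_biasymptotic hX UU ac kc kx kw'.
    have cx : omega_limit_set f c x.
      rewrite oa; apply: (omega_sub_alpha cw').
      by rewrite -(biasymptotic_omega xw').
    apply: nxy; rewrite -(omega_periodic_limit cx).
    apply: (omega_upper_aperiodic hX UU Uoo ac kc _ vy) => i.
    by rewrite omega_ziter.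
  exists c; split=> //; first exact: periodic_exit.
  move=> B /nbhs_mdist_exP[e e0 eB].
  have er0 : 0 < Num.min e r by rewrite lt_min e0.
  (* Radius [r] keeps [V] off [O], hence off the orbit of [x], while the exit points of [u i] enter
     [V]. The crossing yields a boundary point [p] with [x] in its alpha-limit set. *)
  have [V [s [oV Vc Ve bV]]] := regular_nbhs hX c er0.
  have [|p ps px] :=
      cvg_connected_crossing (f := f) (k := fun i => (k i)%:Z) hX UU oV bV ux.
    near=> i; split=> [Vx _|[]]; last first.
      by near: i; apply: (kc V); exact: open_nbhs_nbhs.
    have := Ve _ (subset_closure Vx); rewrite lt_min => /andP[_ cxr].
    have := @dist_to_le R X c O _ (omega_invariant (k i)%:Z rx).
    by lra.
  exists p; split=> /=.
    apply: omega_periodic_limit; rewrite oa; exact: (alpha_of_cvg UU koo px).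
  apply: eB; have : boundary V p by rewrite bV.
  by move=> [/Ve + _]; rewrite lt_min => /andP[].
apply: (hyperspace_ultra_cvg UU) => [v y uv vy|w e xw e0].
  exact: (up v y uv vy).
(* Lower semicontinuity: by [up], any limit [y] of points of these limit sets lies on the periodic
   orbit [O], so its own limit set is all of [O]. *)
have /choice[v uv] := fun i => omega_limit_set_neq0 f (u i).
have [y vy] := ultra_cvg UU v.
apply: (omega_lower UU uv vy) => //.
exact: ((omega_periodic_minimal w q0 qx (up v y uv vy)).2 xw).
Unshelve. all: by end_near. Qed.

End minimality.

Lemma omega_continuous_of_eq_alpha (R : realType) (X : continuumType R)
    (f : homeomorphism X) : regular_curve X ->
  (forall x, omega_limit_set f x = alpha_limit_set f x) ->
  continuous (omega_limit f : X -> hyperspace X).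
Proof.
move=> hX oa x; have [ax|/aperiodicN[q q0 qx]] := pselect (aperiodic f x).
  exact: omega_continuous_aperiodic.
exact: (omega_continuous_periodic hX q0 qx).
Qed.

Theorem theorem3p8 (R : realType) (X : continuumType R)
    (f : homeomorphism X) (hX : regular_curve X) :
  [<-> continuous (omega_limit f : X -> hyperspace X);
       forall x : X, omega_limit_set f x = alpha_limit_set f x;
       continuous (alpha_limit f : X -> hyperspace X)].
Proof.
tfae.
- exact: omega_alpha_of_continuous.
- move=> oa; apply: (@omega_continuous_of_eq_alpha R X (homeo_sym f)) => // x.
  by rewrite omega_sym alpha_sym.
- move=> ac; apply: omega_continuous_of_eq_alpha => // x.
  by apply: esym; exact: (@omega_alpha_of_continuous R X hX (homeo_sym f) ac x).
Qed.
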